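(* For every continuous function $\varphi:\mathbb{C}\to\mathbb{C}$ such that $\psi(t):=|\varphi(e^{it})|^2$ belongs to $\Psi$, every $\gamma\ge\frac{7\pi}{5}$, every $x\in H$ and every $\sigma>0$, $$E_\sigma(x)\le\frac{1}{\sqrt{\mathcal{I}(\psi)}}\;\omega_\varphi\!\left(x;L_{p,V^*}\!\left(\left[0,\tfrac{\gamma}{\sigma}\right]\right)\right)\qquad(2\le p\le\infty),$$ and in particular $$E_\sigma(x)\le\frac{1}{\sqrt{\mathcal{I}(\psi)}}\;\omega_\varphi\!\left(x;\tfrac{\gamma}{\sigma}\right).$$
   Context: $H$ is a complex Hilbert space with norm $\|\cdot\|$. $E$ is a resolution of the identity on the Borel $\sigma$-algebra of $\mathbb{R}$ in $H$: to each Borel set $\beta$ is assigned an orthogonal projection $E(\beta)$ in $H$, with $E(\emptyset)=0$, $E(\mathbb{R})=I$, and $E(\bigcup_j\beta_j)=\sum_jE(\beta_j)$ (strongly) for pairwise disjoint sequences of Borel sets. $dE(t)$ denotes integration with respect to this projection-valued measure. For $\sigma>0$ put $W_\sigma=\{\int_{|t|<\sigma}dE(t)g: g\in H\}$ and $E_\sigma(x)=\inf_{h\in W_\sigma}\|x-h\|$. $\Phi$ is the set of continuous nonnegative $2\pi$-periodic functions $\psi:\mathbb{R}\to\mathbb{R}$ with nowhere dense zero set and $\psi(0)=0$. $\Psi$ is the set of $\psi\in\Phi$ such that (1) $\psi(-t)=\psi(t)$ and $\psi(\pi-t)=\psi(\pi+t)$ for $t\in\mathbb{R}$; (2) $\frac1t\int_0^t\psi(s)\,ds\le\frac1\pi\int_0^\pi\psi(s)\,ds$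 for every $t\in(0,\pi)$. $\mathcal{I}(\psi)=\frac1{2\pi}\int_0^{2\pi}\psi(t)\,dt$. For $x\in H$, $t\in\mathbb{R}$ put $\Delta_t^\varphi x=\int_{-\infty}^{\infty}\varphi(e^{its})\,dE(s)x$. The weight $V^*$ on $[0,1]$ is $V^*(t)=Z(t)/\int_0^1Z(s)\,ds$, where $$Z(t)=\begin{cases}\frac{2t}{7},& t\in[0,\frac17],\\ -\frac{t^2}{2}+\frac{3t}{7}-\frac1{98},& t\in[\frac17,\frac57],\\ \frac{t^2}{2}-t+\frac12,& t\in[\frac57,1].\end{cases}$$ For a weight $V$ on $[0,1]$ (nonnegative, integrable, nonzero a.e., $\int_0^1V=1$), $\delta>0$ and $1\le p<\infty$, $$\omega_\varphi(x;L_{p,V}([0,\delta]))=\left(\frac1\delta\int_0^\delta\|\Delta_t^\varphi x\|^p\,V\!\left(\frac t\delta\right)dt\right)^{1/p},$$ and for $p=\infty$ this quantity is understood as $\omega_\varphi(x;\delta)=\omega_\varphi(x;C([0,\delta]))=\max_{0\le t\le\delta}\|\Delta_t^\varphi x\|$. *)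

(* Defs.v *)
From HB Require Import structures.
From mathcomp Require Import all_boot all_order all_algebra.
From mathcomp Require Import all_classical all_reals all_analysis.
From mathcomp Require Import complex.

Set Implicit Arguments.
Unset Strict Implicit.
Unset Printing Implicit Defensive.

Import Order.TTheory GRing.Theory Num.Theory.
Import numFieldNormedType.Exports.

Local Open Scope classical_set_scope.
Local Open Scope ring_scope.
Local Open Scope complex_scope.

(* A norm over the field R[i] takes its values in R[i]; [rnorm] reads it as a
   real number.  It is used both for vectors and for the modulus on R[i]. *)
Definition rnorm (R : realType) (V : normedZmodType R[i]) (v : V) : R :=
  complex.Re `|v|.

Definition expi (R : realType) (t : R) : R[i] := cos t +i* sin t.

Section HilbertSpace.
Context {R : realType} {H : completeNormedModType R[i]}.

(* Together with the completeness of [H], this makes [(H, dot)] a Hilbert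
   space; [dot] is linear in its first argument. *)
Definition norm_from_dot (dot : {dot H for @Num.conj R[i]}) : Prop :=
  forall x : H, `|x| ^+ 2 = dot x x.

Definition orthogonal_projection (dot : {dot H for @Num.conj R[i]})
    (P : H -> H) : Prop :=
  [/\ linear P,
      forall x, P (P x) = P x
    & forall x y, dot (P x) y = dot x (P y)].

(* [measurable] on R is the Borel sigma-algebra; the values of [E] on
   non-measurable sets are irrelevant. *)
Record resolution_of_identity (dot : {dot H for @Num.conj R[i]})
    (E : set R -> H -> H) : Prop := ResolutionOfIdentity {
  roi_proj : forall B, measurable B -> orthogonal_projection dot (E B);
  roi_set0 : forall x, E set0 x = 0;
  roi_setT : forall x, E setT x = x;
  roi_sigma_additive : forall B : (set R)^nat,
    (forall n, measurable (B n)) -> trivIset setT B ->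
    forall x, series (fun n => E (B n) x) @ \oo --> E (\bigcup_n B n) x }.

Definition simple_function (s : R -> R[i]) : Prop :=
  finite_set (range s) /\ forall c, measurable (s @^-1` [set c]).

Definition simple_integral (E : set R -> H -> H) (s : R -> R[i]) (x : H) : H :=
  \sum_(c \in range s) c *: E (s @^-1` [set c]) x.

(* The integral of a bounded Borel function is the limit of the integrals of
   simple functions converging to it uniformly. *)
Definition is_spectral_integral (E : set R -> H -> H) (f : R -> R[i])
    (x y : H) : Prop :=
  exists s : nat -> R -> R[i],
  [/\ forall n, simple_function (s n),
      forall e : R, 0 < e ->
        \forall n \near \oo, forall t, rnorm (s n t - f t) < e
    & (fun n => simple_integral E (s n) x) @ \oo --> y].

(* [\int_D f dE x]; it is [0] when the integral above does not exist. *)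
Definition spectral_integral (E : set R -> H -> H) (D : set R)
    (f : R -> R[i]) (x : H) : H :=
  xget 0 (is_spectral_integral E (fun t => f t * (\1_D t)%:C) x).

Definition W (E : set R -> H -> H) (sigma : R) : set H :=
  [set spectral_integral E [set t | `|t| < sigma] (fun=> 1) g | g in setT].

Definition best_approx (E : set R -> H -> H) (sigma : R) (x : H) : R :=
  inf [set rnorm (x - h) | h in W E sigma].

Definition Delta (E : set R -> H -> H) (phi : R[i] -> R[i]) (t : R) (x : H)
    : H :=
  spectral_integral E setT (fun s => phi (expi (t * s))) x.

Definition omega_C (E : set R -> H -> H) (phi : R[i] -> R[i]) (x : H)
    (delta : R) : R :=
  sup [set rnorm (Delta E phi t x) | t in `[0, delta]].

(* Only the exponents [1 <= p <= +oo] are meaningful. *)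
Definition omega (E : set R -> H -> H) (phi : R[i] -> R[i]) (x : H)
    (p : \bar R) (V : R -> R) (delta : R) : R :=
  match p with
  | q%:E => (delta^-1 * \int[lebesgue_measure]_(t in `[0, delta])
                (rnorm (Delta E phi t x) `^ q * V (t / delta))) `^ q^-1
  | +oo%E => omega_C E phi x delta
  | -oo%E => 0
  end.

End HilbertSpace.

Section Classes.
Context {R : realType}.
Implicit Type psi : R -> R.

Definition nowhere_dense (A : set R) : Prop := interior (closure A) = set0.

Definition Phi psi : Prop :=
  [/\ continuous psi,
      forall t, 0 <= psi t,
      periodic psi (2 * pi),
      nowhere_dense [set t | psi t = 0]
    & psi 0 = 0].

Definition Psi psi : Prop :=
  [/\ Phi psi,
      forall t, psi (- t) = psi t /\ psi (pi - t) = psi (pi + t)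
    & forall t, 0 < t < pi ->
        t^-1 * \int[lebesgue_measure]_(s in `[0, t]) psi s
        <= pi^-1 * \int[lebesgue_measure]_(s in `[0, pi]) psi s].

Definition mean psi : R :=
  (2 * pi)^-1 * \int[lebesgue_measure]_(t in `[0, 2 * pi]) psi t.

(* Only the values on [0, 1] matter. *)
Definition Z (t : R) : R :=
  if t <= 1 / 7 then 2 * t / 7
  else if t <= 5 / 7 then - (t ^+ 2 / 2) + 3 * t / 7 - 1 / 98
  else t ^+ 2 / 2 - t + 1 / 2.

Definition Vstar (t : R) : R :=
  Z t / \int[lebesgue_measure]_(s in `[0, 1]) Z s.

End Classes.

(* Main.v *)
(** Put [m := mean psi], [d := gamma / sigma] and
    [mu B := |E(B) x|^2], a finite measure with [|Delta_t x|^2 = \int psi(ts) dmu(s)].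
    By Fubini the weighted mean of [|Delta_t x|^2] over [[0, d]] is at least
    [m * mu(|s| >= sigma) >= m * E_sigma(x)^2] as soon as
    [\int_0^1 psi(au) V^*(u) du >= m] for every [a >= 7 pi / 5]; the exponents
    [p >= 2] then follow by convexity.

    For the scalar inequality integrate by parts twice.  Let [P] be the primitive
    of [psi - m] and [G] that of [-P], both vanishing at 0.  Condition (2) says
    that [P <= 0] on [[0, pi]], so [G] is even, [2 pi]-periodic and nondecreasing
    on [[0, pi]].  As [Z'' = 0, -1, 1] on the three pieces and [Z(0) = Z(1) =
    Z'(1) = 0], the inequality becomes [\int_{5r}^{7r} G <= \int_r^{5r} G] with
    [r = a / 7 >= pi / 5]. *)

Require Import Defs.
From HB Require Import structures.
From mathcomp Require Import all_boot all_order all_algebra.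
From mathcomp Require Import all_classical all_reals all_analysis.
From mathcomp Require Import complex.
From mathcomp Require Import measurable_realfun zify ring lra.

Set Implicit Arguments.
Unset Strict Implicit.
Unset Printing Implicit Defensive.

Import Order.TTheory GRing.Theory Num.Theory.
Import numFieldNormedType.Exports.

Local Open Scope classical_set_scope.
Local Open Scope ring_scope.
Local Open Scope complex_scope.

(** * Primitives of continuous functions *)

Section Primitives.
Context {R : realType}.
Implicit Types (f g F G : R -> R) (a b c t : R).

(** Hypothesis (2) bounds only averages of [psi], so values of [psi] cannot be compared pointwise.
    Two integrations by parts trade [psi] for [G], whose monotonicity on a half-period is what (2)
    provides, and a rearrangement of [G] can then be compared point by point. The knots [1/7],
    [5/7], [1] become [r], [5r], [7r]: the interval [[r, 5r]] is twice as long as [[5r, 7r]], which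
    leaves room to fit the latter into it modulo the period once [r] is large. The constant
    [7 pi / 5] comes from the smallest admissible [r]: near [5r], the bound [G(5r + s) <= G(5r - s)]
    amounts to [5r >= pi].

    On the Hilbert space side, [E] is given only by additivity, and [spectral_integral] is a choice
    among possible limits. Orthogonality of projections on disjoint sets, existence and uniqueness
    of the integral, and the isometry with [L^2(mu)] have to be derived before Fubini applies. *)

Definition primitive F f : Prop := forall t, is_derive t 1 F (f t).

Lemma primitive_ext F f g : f =1 g -> primitive F f -> primitive F g.
Proof. by move=> fg Ff t; rewrite -fg. Qed.

Lemma primitive_eq F G f g : F =1 G -> f =1 g -> primitive F f -> primitive G g.
Proof. by move=> /funext -> /funext ->. Qed.

Lemma primitive_cst c : primitive (fun=> c) (fun=> 0).
Proof. by move=> t; exact: is_derive_cst. Qed.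

Lemma primitive_id : primitive id (fun=> 1).
Proof. by move=> t; exact: is_derive_id. Qed.

Lemma primitiveD F G f g : primitive F f -> primitive G g ->
  primitive (fun t => F t + G t) (fun t => f t + g t).
Proof. by move=> Ff Gg t; exact: is_deriveD. Qed.

Lemma primitiveB F G f g : primitive F f -> primitive G g ->
  primitive (fun t => F t - G t) (fun t => f t - g t).
Proof. by move=> Ff Gg t; exact: is_deriveB. Qed.

Lemma primitiveN F f : primitive F f -> primitive (fun t => - F t) (fun t => - f t).
Proof. by move=> Ff t; exact: is_deriveN. Qed.

Lemma primitiveM F G f g : primitive F f -> primitive G g ->
  primitive (fun t => F t * G t) (fun t => f t * G t + F t * g t).
Proof.
move=> Ff Gg t; apply: (is_derive_eq (is_deriveM (Ff t) (Gg t))).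
by rewrite /GRing.scale/= addrC mulrC.
Qed.

Lemma primitiveZ c F f : primitive F f ->
  primitive (fun t => c * F t) (fun t => c * f t).
Proof. by move=> Ff t; exact: is_deriveZ. Qed.

Lemma primitive_affine a b F f : primitive F f ->
  primitive (fun t => F (a * t + b)) (fun t => a * f (a * t + b)).
Proof.
move=> Ff t.
have dg : is_derive t 1 (fun s : R => a * s + b) a.
  by apply: (is_derive_eq (primitiveD (primitiveZ a primitive_id) (primitive_cst b) t));
    rewrite mulr1 addr0.
rewrite mulrC; exact: (is_derive1_comp (f := F) (g := fun s => a * s + b)).
Qed.

Lemma primitive_scale a F f : primitive F f ->
  primitive (fun t => F (a * t)) (fun t => a * f (a * t)).
Proof.
by move=> /(primitive_affine a 0); apply: primitive_eq => t; rewrite addr0.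
Qed.

Lemma primitive_shift b F f : primitive F f ->
  primitive (fun t => F (t + b)) (fun t => f (t + b)).
Proof.
by move=> /(primitive_affine 1 b); apply: primitive_eq => t; rewrite !mul1r.
Qed.

Lemma primitive_reflect b F f : primitive F f ->
  primitive (fun t => F (b - t)) (fun t => - f (b - t)).
Proof.
by move=> /(primitive_affine (-1) b); apply: primitive_eq => t; rewrite !mulN1r [- _ + _]addrC.
Qed.

Lemma primitive_continuous F f : primitive F f -> continuous F.
Proof.
by move=> Ff t; apply: differentiable_continuous; apply/derivable1_diffP; case: (Ff t).
Qed.

Lemma primitive_unique F G f : primitive F f -> primitive G f ->
  forall s t, F s - G s = F t - G t.
Proof.
move=> Ff Gf s t.
apply: (@is_derive_0_is_cst _ (fun t => F t - G t)) => u.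
by apply: (is_derive_eq (primitiveB Ff Gf u)); rewrite subrr.
Qed.

Lemma primitive_le F f a b : primitive F f -> a <= b ->
  (forall t, a <= t <= b -> 0 <= f t) -> F a <= F b.
Proof.
move=> Ff ab f0.
have [c] := MVT_segment ab (fun t _ => Ff t)
  (@continuous_subspaceT _ _ _ _ (primitive_continuous Ff)).
by rewrite in_itv/= => /f0 fc0 FE; rewrite -subr_ge0 FE mulr_ge0// subr_ge0.
Qed.

Let mu := @lebesgue_measure R.

Lemma continuous_integrable f a b : continuous f -> mu.-integrable `[a, b] (EFin \o f).
Proof.
by move=> cf; apply: continuous_compact_integrable;
  [exact: segment_compact | exact: continuous_subspaceT].
Qed.

Lemma continuous_Rintegral_split f a b c : continuous f -> a <= b -> b <= c ->
  \int[mu]_(t in `[a, c]) f t =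
  \int[mu]_(t in `[a, b]) f t + \int[mu]_(t in `[b, c]) f t.
Proof.
move=> cf ab bc; apply/eqP; rewrite addrC -subr_eq; apply/eqP.
rewrite (@Rintegral_itvB _ f (BLeft a) (BRight c) b) ?bnd_simp//;
  last exact: continuous_integrable.
apply: Rintegral_itv_obnd_cbnd.
by apply: (@integrableS _ _ _ mu `[b, c]) => //;
  [exact: subset_itv_oc_cc | exact: continuous_integrable].
Qed.

Lemma primitive_Rintegral F f a b : continuous f -> primitive F f -> a <= b ->
  \int[mu]_(t in `[a, b]) f t = F b - F a.
Proof.
move=> cf Ff; rewrite le_eqVlt => /predU1P[->|ab].
  by rewrite set_itv1 Rintegral_set1 subrr.
rewrite /Rintegral (@continuous_FTC2 _ f F)//.
- exact: continuous_subspaceT.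
- have cF := primitive_continuous Ff.
  split=> [t _||].
  + by case: (Ff t).
  + by apply: cvg_at_right_filter; exact: cF.
  + by apply: cvg_at_left_filter; exact: cF.
- by move=> t _; rewrite derive1E; case: (Ff t).
Qed.

(** The set [[a, b]] is empty when [b < a], so [I 0 t - I t 0] is the oriented integral from 0 to
    [t]. *)
Lemma exists_primitive f : continuous f -> exists2 F, F 0 = 0 & primitive F f.
Proof.
move=> cf.
pose I a b := \int[mu]_(t in `[a, b]) f t.
have IC a b c : a <= b -> b <= c -> I a c = I a b + I b c.
  exact: continuous_Rintegral_split.
exists (fun t => I 0 t - I t 0); first by rewrite subrr.
move=> t.
(* A base point to the left of both [t] and 0: near [t] the oriented integral differs from [I n] by
   a constant, and the one-sided fundamental theorem applies to [I n]. *)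
pose n := - (`|t| + 1).
have nt : n < t.
  by rewrite /n; have := ler_norm (- t); rewrite normrN; lra.
have n0 : n < 0 by rewrite /n; have := normr_ge0 t; lra.
have [d1 d2] := continuous_FTC1_closed (ltr_pwDr ltr01 (lexx t))
  (@continuous_integrable f n (t + 1) cf) nt (cf t).
have dI : is_derive t 1 (I n) (f t).
  by apply: (DeriveDef d1); rewrite -derive1E; exact: d2.
have dJ : is_derive t 1 (fun s => I n s - I n 0) (f t).
  have dc : is_derive t 1 (fun _ : R => I n 0) (0 : R) by exact: is_derive_cst.
  by apply: (is_derive_eq (is_deriveB dI dc)); rewrite subr0.
have nearE : \forall s \near t, I n s - I n 0 = I 0 s - I s 0.
  near=> s.
  have ns : n < s by near: s; exact: lt_nbhsr.
  have I0 a b : b < a -> I a b = 0.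
    by move=> ba; rewrite /I set_itv_ge ?Rintegral_set0// bnd_simp -ltNge.
  have [s0|s0|->] := ltgtP s 0.
  - by rewrite (IC n s 0)// ?ltW// (I0 0 s)// opprD addrA subrr.
  - by rewrite (IC n 0 s)// ?ltW// (I0 s 0)// subr0 addrAC subrr add0r.
  - by rewrite !subrr.
exact: near_eq_is_derive nearE dJ.
Unshelve. all: by end_near. Qed.

End Primitives.

(** * Periodic functions that are monotone on a half-period *)

Section PeriodicPrimitives.
Context {R : realType}.
Implicit Types (f g F G K : R -> R) (a b c r t : R).

Lemma primitive_odd F f : (forall t, f (- t) = f t) -> primitive F f -> F 0 = 0 ->
  forall t, F (- t) = - F t.
Proof.
move=> f_even Ff F0 t.
have Gf : primitive (fun t => - F (0 - t)) f.
  apply: primitive_ext (primitiveN (primitive_reflect 0 Ff)) => s.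
  by rewrite opprK sub0r f_even.
have := primitive_unique Ff Gf t 0; rewrite subr0 F0 oppr0 subr0 sub0r.
by move=> /eqP; rewrite opprK addr_eq0 => /eqP ->; rewrite opprK.
Qed.

Lemma primitive_even F f : (forall t, f (- t) = - f t) -> primitive F f ->
  forall t, F (- t) = F t.
Proof.
move=> f_odd Ff t.
have Gf : primitive (fun t => F (0 - t)) f.
  by apply: primitive_ext (primitive_reflect 0 Ff) => s; rewrite sub0r f_odd opprK.
have := primitive_unique Ff Gf t 0; rewrite subr0 subrr sub0r => /eqP.
by rewrite subr_eq0 => /eqP.
Qed.

Lemma primitive_periodic F f T : (forall t, f (t + T) = f t) -> primitive F f ->
  F 0 = 0 -> forall t, F (t + T) = F t + F T.
Proof.
move=> f_per Ff F0 t.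
have Gf : primitive (fun t => F (t + T)) f.
  by apply: primitive_ext (primitive_shift T Ff) => s.
have := primitive_unique Gf Ff t 0; rewrite F0 add0r subr0 => /eqP.
by rewrite subr_eq => /eqP ->; rewrite addrC.
Qed.

Lemma natmul_periodic F T d n t : (forall t, F (t + T) = F t + d) ->
  F (t + T *+ n) = F t + d *+ n.
Proof.
move=> FT; elim: n t => [|n IH] t; first by rewrite !mulr0n !addr0.
by rewrite !mulrSr !addrA FT IH.
Qed.

Lemma truncn_mulrn (T t : R) : 0 < T -> 0 <= t ->
  T *+ Num.truncn (t / T) <= t < T *+ (Num.truncn (t / T)).+1.
Proof.
move=> T0 t0.
have := Num.Theory.truncn_itv (divr_ge0 t0 (ltW T0)).
by rewrite ler_pdivlMr// ltr_pdivrMr// !mulr_natl.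
Qed.

Section Unimodal.
Variables (f K : R -> R).
Hypothesis f_even : forall t, f (- t) = f t.
Hypothesis f_per : forall t, f (t + 2 * pi) = f t.
Hypothesis f_0 : f 0 = 0.
Hypothesis f_ndecr : forall a b, 0 <= a -> a <= b -> b <= pi -> f a <= f b.
Hypothesis Kf : primitive K f.
Hypothesis K_0 : K 0 = 0.

(** The value of [f] does not decrease with the distance to the nearest multiple of [2 * pi], and
    the hypotheses say that [b] is at least as far from these multiples as [a]. *)
Lemma unimodal_le a b : 0 <= a -> a <= b -> b <= 2 * pi - a -> f a <= f b.
Proof.
move=> a0 ab bpa; have [bpi|pib] := leP b pi; first exact: f_ndecr.
have -> : f b = f (2 * pi - b) by rewrite -[RHS]f_even opprB -[RHS]f_per subrK.
by apply: f_ndecr; lra.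
Qed.

Lemma unimodal_ge0 t : 0 <= t -> 0 <= f t.
Proof.
have pi0 := pi_gt0 R.
move=> t0; have T0 : 0 < 2 * pi :> R by lra.
have /andP[t1 t2] := truncn_mulrn T0 t0.
set n := Num.truncn _ in t1 t2.
have := @natmul_periodic f (2 * pi) 0 n (t - 2 * pi *+ n).
rewrite subrK mul0rn addr0 => -> ; last by move=> s; rewrite addr0.
rewrite -[leLHS]f_0; apply: unimodal_le => //; first by rewrite subr_ge0.
by rewrite subr0 lerBlDr -mulrS ltW.
Qed.

Lemma unimodal_primitive_ndecr a b : 0 <= a -> a <= b -> K a <= K b.
Proof.
move=> a0 ab; apply: (primitive_le Kf) => // t /andP[at_ _].
exact/unimodal_ge0/(le_trans a0).
Qed.

Lemma unimodal_primitive_natmul n t : K (t + 2 * pi *+ n) = K t + K (2 * pi) *+ n.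
Proof. by apply: natmul_periodic => s; exact: primitive_periodic. Qed.

(* The comparison is by a measure-preserving rearrangement of [5r, 7r] into
   [r, 5r] under which f does not decrease: reflection about 5r for small r,
   two translations for intermediate r, translation by a multiple of the period for
   large r. *)
Lemma unimodal_primitive_comparison r : pi / 5 <= r -> K r - 2 * K (5 * r) + K (7 * r) <= 0.
Proof.
have pi0 := pi_gt0 R; move=> r_ge; have r0 : 0 < r by lra.
have [r1|r1] := leP r (2 * pi / 5).
  have K31 : K r <= K (3 * r) by apply: unimodal_primitive_ndecr; lra.
  have Q : primitive (fun s => - (K (s + 5 * r) + K (5 * r - s)))
                     (fun s => - (f (s + 5 * r) + - f (5 * r - s))).
    by apply/primitiveN/primitiveD;
      [exact: primitive_shift | exact: primitive_reflect].
  have := primitive_le (b := 2 * r) Q.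
  have -> : 2 * r + 5 * r = 7 * r by ring.
  have -> : 5 * r - 2 * r = 3 * r by ring.
  move=> /(_ 0); rewrite add0r subr0 => H.
  suff : - (K (5 * r) + K (5 * r)) <= - (K (7 * r) + K (3 * r)) by lra.
  apply: H; first lra.
  move=> s /andP[s0 s2]; rewrite -opprB opprK subr_ge0.
  (* Folding [5r + s] back by symmetry reduces the comparison to [2 pi <= 10 r], the lower bound on
     [r]. Past [2 * pi] it is shifted by a period instead, and the comparison needs [10 r <= 4 pi],
     the threshold of this case. *)
  have [v|v] := leP (s + 5 * r) (2 * pi).
    have -> : f (s + 5 * r) = f (2 * pi - (s + 5 * r)).
      by rewrite -[LHS]f_even -[LHS]f_per addrC.
    by apply: unimodal_le; lra.
  have -> : f (s + 5 * r) = f (s + 5 * r - 2 * pi) by rewrite -[RHS]f_per subrK.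
  by apply: unimodal_le; lra.
have [r2|r2] := leP r (pi / 2).
  (* Modulo the period, [[5r, 7r]] becomes [[5r - 2 pi, 7r - 2 pi]]. Its part to the left of [r] is
     moved by a further [2r] onto [[7r - 2 pi, 3r]], which completes [[r, 3r]]. The shift from [s]
     to [s + 2r] increases [f] for [s <= r] because [4r <= 2 pi]. *)
  have K53 : K (3 * r) <= K (5 * r) by apply: unimodal_primitive_ndecr; lra.
  have K7 : K (7 * r) = K (7 * r - 2 * pi) + K (2 * pi).
    by rewrite -(primitive_periodic f_per Kf K_0) subrK.
  have K5 : K (5 * r) = K (5 * r - 2 * pi) + K (2 * pi).
    by rewrite -(primitive_periodic f_per Kf K_0) subrK.
  have Q : primitive (fun s => K (s + 2 * r) - K s) (fun s => f (s + 2 * r) - f s).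
    by apply: primitiveB => //; exact: primitive_shift.
  have := primitive_le (a := 5 * r - 2 * pi) (b := r) Q.
  have -> : 5 * r - 2 * pi + 2 * r = 7 * r - 2 * pi by ring.
  have -> : r + 2 * r = 3 * r by ring.
  move=> H.
  suff : K (7 * r - 2 * pi) - K (5 * r - 2 * pi) <= K (3 * r) - K r by lra.
  apply: H; first lra.
  by move=> s /andP[s0 s2]; rewrite subr_ge0; apply: unimodal_le; lra.
(* These bounds say exactly that [[5r, 7r]] shifted left by [n] periods lies inside [[r, 5r]]. *)
have [n n2 n4] : exists2 n : nat, 2 * r <= 2 * pi *+ n & 2 * pi *+ n <= 4 * r.
  have [rpi|pir] := ltP r pi; first by exists 1%N; rewrite mulr1n; lra.
  have /andP[t1 t2] := truncn_mulrn pi0 (ltW r0).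
  set n := Num.truncn _ in t1 t2.
  by exists n.+1; move: t2; rewrite mulrSr -mulrnAr mulrSr; lra.
have K7 : K (7 * r) = K (7 * r - 2 * pi *+ n) + K (2 * pi) *+ n.
  by rewrite -unimodal_primitive_natmul subrK.
have K5 : K (5 * r) = K (5 * r - 2 * pi *+ n) + K (2 * pi) *+ n.
  by rewrite -unimodal_primitive_natmul subrK.
have : K (7 * r - 2 * pi *+ n) <= K (5 * r) by apply: unimodal_primitive_ndecr; lra.
have : K r <= K (5 * r - 2 * pi *+ n) by apply: unimodal_primitive_ndecr; lra.
lra.
Qed.

End Unimodal.

End PeriodicPrimitives.

(** * The weight V^* *)

Section Weight.
Context {R : realType}.
Implicit Types (f g F G K : R -> R) (a b c d r t : R).
Let mu := @lebesgue_measure R.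

(** This is the truncated-power form of a [C^1] quadratic spline: the coefficients record the jumps
    [-1] and [2] of [Z''] at the two knots. It makes continuity immediate and lets either piece be
    used at a knot. *)
Lemma ZE t : Z t = 2 * t / 7 - (Num.max 0 (t - 1 / 7)) ^+ 2 / 2
                   + (Num.max 0 (t - 5 / 7)) ^+ 2.
Proof.
rewrite /Z; case: (leP t (1 / 7)) => t1.
  by rewrite !max_l; [ring|lra|lra].
rewrite (max_r (_ : 0 <= t - 1 / 7)); last lra.
case: (leP t (5 / 7)) => t5.
  by rewrite max_l; [field|lra].
by rewrite max_r; [field|lra].
Qed.

Lemma Z_continuous : continuous (@Z R).
Proof.
have -> : @Z R = fun t => 2 * t / 7 - (Num.max 0 (t - 1 / 7)) ^+ 2 / 2
                   + (Num.max 0 (t - 5 / 7)) ^+ 2 by apply/funext => t; exact: ZE.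
have cmax c : continuous (fun t : R => Num.max 0 (t - c)).
  move=> t; apply: (@continuous_max R R (cst 0) (fun t : R => t - c) t).
    exact: cst_continuous.
  by apply: cvgB; [exact: cvg_id|exact: cvg_cst].
move=> t; apply: cvgD; last exact: (cvgM (cmax _ t) (cmax _ t)).
apply: cvgB; apply: cvgM; [|exact: cvg_cst| |exact: cvg_cst].
  by apply: cvgM; [exact: cvg_cst|exact: cvg_id].
exact: (cvgM (cmax _ t) (cmax _ t)).
Qed.

Lemma Z_ge0 t : 0 <= t <= 1 -> 0 <= Z t.
Proof.
move=> /andP[t0 t1]; rewrite /Z; case: ifPn => [_|]; first lra.
rewrite -ltNge => t2; case: ifPn => [|_]; first nra.
by have := sqr_ge0 (t - 1); rewrite expr2; nra.
Qed.

Lemma ZM_continuous g d : continuous g -> continuous (fun t => g t * Z (t / d)).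
Proof.
move=> cg t; apply: cvgM; first exact: cg.
apply: (@continuous_comp _ _ _ (fun t => t / d) (@Z R)); last exact: Z_continuous.
by apply: cvgM; [exact: cvg_id|exact: cvg_cst].
Qed.

Lemma eq_itv_Rintegral f a b g : (forall t, a <= t <= b -> f t = g t) ->
  \int[mu]_(t in `[a, b]) f t = \int[mu]_(t in `[a, b]) g t.
Proof. by move=> fg; apply: eq_Rintegral => t; rewrite inE/= in_itv/=; exact: fg. Qed.

(** With [q] the quadratic factor, [T] is [q g1 - q' g2 + q'' g3], the result of repeated
    integration by parts; it is a primitive of [g q] since [q''' = 0]. Free coefficients let it
    serve all three pieces of [Z]. *)
Lemma Rintegral_quadratic g g1 g2 g3 d A B C a b : d != 0 ->
  continuous g -> primitive g1 g -> primitive g2 g1 -> primitive g3 g2 -> a <= b ->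
  let T t := (A * (t / d) ^+ 2 + B * (t / d) + C) * g1 t
             - (2 * A * (t / d) + B) / d * g2 t + 2 * A / d ^+ 2 * g3 t in
  \int[mu]_(t in `[a, b]) (g t * (A * (t / d) ^+ 2 + B * (t / d) + C)) = T b - T a.
Proof.
move=> d0 cg p1 p2 p3 ab T; apply: primitive_Rintegral; [| |exact: ab].
  move=> t; apply: cvgM; first exact: cg.
  have ct : (fun t => t / d) @ t --> t / d by apply: cvgM; [exact: cvg_id|exact: cvg_cst].
  apply: cvgD; last exact: cvg_cst.
  apply: cvgD; apply: cvgM; [exact: cvg_cst| |exact: cvg_cst|exact: ct].
  exact: (cvgM ct ct).
have pd : primitive (fun t => d^-1 * t) (fun _ => d^-1 * 1).
  exact/primitiveZ/primitive_id.
have q2 : primitive (fun t => A * ((d^-1 * t) * (d^-1 * t)) + B * (d^-1 * t) + C) _ :=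
  primitiveD (primitiveD (primitiveZ A (primitiveM pd pd)) (primitiveZ B pd))
    (primitive_cst C).
have q1 : primitive (fun t => 2 * A * (d^-1 * t) + B) _ :=
  primitiveD (primitiveZ (2 * A) pd) (primitive_cst B).
have := primitiveD (primitiveB (primitiveM q2 p1)
   (primitiveM (primitiveZ d^-1 q1) p2)) (primitiveZ (2 * A / d ^+ 2) p3).
by apply: primitive_eq => t; rewrite /T; field.
Qed.

(** Since [Z] and [Z'] are continuous, the boundary terms at the knots cancel except for the jumps
    of [Z''], which leave the coefficients [1] and [-2] of [g3]. At [d] only [Z'' = 1] survives, and
    at 0 only the slope [Z'(0) = 2/7]. *)
Lemma Rintegral_Z g g1 g2 g3 d : 0 < d ->
  continuous g -> primitive g1 g -> primitive g2 g1 -> primitive g3 g2 ->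
  \int[mu]_(t in `[0, d]) (g t * Z (t / d)) =
  d ^- 2 * (g3 (d / 7) - 2 * g3 (5 * d / 7) + g3 d) + 2 / (7 * d) * g2 0.
Proof.
move=> d0 cg p1 p2 p3; have dn0 : d != 0 by rewrite gt_eqF.
rewrite (@continuous_Rintegral_split _ _ _ (d / 7)); [|exact: ZM_continuous|lra|lra].
rewrite (@continuous_Rintegral_split _ _ (d / 7) (5 * d / 7)); [|exact: ZM_continuous|lra|lra].
have RQ A B C a b := @Rintegral_quadratic _ _ _ _ d A B C a b dn0 cg p1 p2 p3.
rewrite (@eq_itv_Rintegral _ 0 (d / 7)
  (fun t => g t * (0 * (t / d) ^+ 2 + 2 / 7 * (t / d) + 0))); last first.
  move=> t /andP[t0 t1]; congr (_ * _).
  by rewrite /Z ler_pdivrMr// ifT; [ring|lra].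
rewrite (@eq_itv_Rintegral _ (d / 7) (5 * d / 7)
  (fun t => g t * (- (1 / 2) * (t / d) ^+ 2 + 3 / 7 * (t / d) + - (1 / 98)))); last first.
  move=> t /andP[t0 t1]; congr (_ * _).
  rewrite ZE max_r; last by rewrite subr_ge0 ler_pdivlMr//; lra.
  by rewrite max_l; [field|rewrite subr_le0 ler_pdivrMr//; lra].
rewrite (@eq_itv_Rintegral _ (5 * d / 7) d
  (fun t => g t * (1 / 2 * (t / d) ^+ 2 + -1 * (t / d) + 1 / 2))); last first.
  move=> t /andP[t0 t1]; congr (_ * _).
  rewrite ZE max_r; last by rewrite subr_ge0 ler_pdivlMr//; lra.
  by rewrite max_r; [field|rewrite subr_ge0 ler_pdivlMr//; lra].
rewrite !RQ; [|lra..].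
by field.
Qed.

Lemma primitive_sqr_half : primitive (fun t => t ^+ 2 / 2) (@id R).
Proof.
have := primitiveZ 2^-1 (primitiveM (@primitive_id R) (@primitive_id R)).
by apply: primitive_eq => t; field.
Qed.

Lemma primitive_cube_sixth : primitive (fun t => t ^+ 3 / 6) (fun t : R => t ^+ 2 / 2).
Proof.
have := primitiveZ 3^-1 (primitiveM primitive_sqr_half (@primitive_id R)).
by apply: primitive_eq => t; field.
Qed.

Lemma Rintegral_Z_cst c d : 0 < d ->
  \int[mu]_(t in `[0, d]) (c * Z (t / d)) = 47 / 1029 * c * d.
Proof.
move=> d0.
rewrite (@Rintegral_Z _ (fun t => c * t) (fun t => c * (t ^+ 2 / 2))
  (fun t => c * (t ^+ 3 / 6)))//.
(* The constant is [(1/343 - 2 * 125/343 + 1) / 6 = 47/1029]. *)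
- by field; rewrite gt_eqF.
- exact: cst_continuous.
- by apply: primitive_ext (primitiveZ c (@primitive_id R)) => t; rewrite mulr1.
- exact: (primitiveZ _ primitive_sqr_half).
- exact: (primitiveZ _ primitive_cube_sixth).
Qed.

Lemma VstarE t : Vstar t = 1029 / 47 * Z t.
Proof.
rewrite /Vstar.
have -> : \int[lebesgue_measure]_(s in `[0, 1]) Z s = 47 / 1029 :> R.
  have := Rintegral_Z_cst 1 ltr01; rewrite !mulr1 => <-.
  by apply: eq_Rintegral => s _; rewrite mul1r divr1.
by field.
Qed.

End Weight.

(** * The scalar inequality for the class Psi *)

Section PsiClass.
Context {R : realType}.
Implicit Types (f psi : R -> R) (a b c d r t : R).
Let mu := @lebesgue_measure R.

(** A zero integral would make the nondecreasing primitive constant on [[a, b]], hence its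
    derivative [f c] zero. *)
Lemma Rintegral_continuous_gt0 f a b c : continuous f ->
  (forall t, a <= t <= b -> 0 <= f t) -> a < c < b -> 0 < f c ->
  0 < \int[mu]_(t in `[a, b]) f t.
Proof.
move=> cf f0 /andP[ac cb] fc0.
have [F _ Ff] := exists_primitive cf.
rewrite (primitive_Rintegral cf Ff); last by lra.
have Fle s t : a <= s -> s <= t -> t <= b -> F s <= F t.
  move=> as_ st tb; apply: (primitive_le Ff) => // u /andP[su ut].
  by apply: f0; rewrite (le_trans as_) ?(le_trans ut).
suff : F a < F b by rewrite subr_gt0.
rewrite ltNge; apply/negP => Fba.
have Fcst t : a <= t <= b -> F t = F a.
  move=> /andP[at_ tb]; apply/eqP; rewrite eq_le (le_trans (Fle t b _ _ _))//=.
  exact: Fle.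
have [] : is_derive c 1 F (f c) by exact: Ff.
move=> _; rewrite (@near_eq_derive _ _ _ _ (cst (F a))).
  by rewrite derive_cst => fE; rewrite -fE ltxx in fc0.
near=> t; apply: Fcst.
have at_ : a < t by near: t; exact: lt_nbhsr.
have tb : t < b by near: t; exact: lt_nbhsl.
by rewrite !ltW.
Unshelve. all: by end_near. Qed.

(** Otherwise [psi] vanishes on []0, 2 pi[], so [pi] is interior to its zero set, which is nowhere
    dense. *)
Lemma mean_gt0 psi : Phi psi -> 0 < mean psi.
Proof.
have pi0 := pi_gt0 R; move=> [cpsi psi0 _ nd _].
have two_pi : 0 < 2 * pi :> R by rewrite mulr_gt0.
rewrite /mean mulr_gt0 ?invr_gt0//.
have [[c c01 psic]|H] := pselect (exists2 c, 0 < c < 2 * pi & psi c != 0).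
  by apply: (@Rintegral_continuous_gt0 _ _ _ c) => //; rewrite lt_neqAle eq_sym psic/=.
exfalso.
have : interior (closure [set t | psi t = 0]) pi.
  apply: (@filterS _ _ _ `]0, (2 * pi)[).
    move=> t /=; rewrite in_itv/= => t0; apply: subset_closure => /=.
    by apply: contra_notP H => /eqP ?; exists t.
  by apply: near_in_itvoo; rewrite in_itv/= pi0; lra.
by rewrite nd.
Qed.

Lemma Psi_weighted_mean psi c d : Psi psi -> 0 < c -> 0 < d -> 7 * pi / 5 <= c * d ->
  mean psi * d <= \int[mu]_(t in `[0, d]) (psi (c * t) * Vstar (t / d)).
Proof.
have pi0 := pi_gt0 R; move=> [[cpsi psi0 psi_per _ _] psi_sym psi_avg] c0 d0 cd.
set m := mean psi.
have psi_even t : psi (- t) = psi t by case: (psi_sym t).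
have [Q Q0 Qpsi] := exists_primitive cpsi.
have Q_odd := primitive_odd psi_even Qpsi Q0.
have Q_per := primitive_periodic psi_per Qpsi Q0.
(* Evenness makes the mean over a period equal to the mean over [[0, pi]], the one that occurs in
   condition (2). *)
have Q2pi : Q (2 * pi) = 2 * Q pi.
  have := Q_per (- pi); rewrite Q_odd (_ : - pi + 2 * pi = pi); last by ring.
  by move=> H; lra.
have mE : m = Q pi / pi.
  rewrite /m /mean (primitive_Rintegral cpsi Qpsi); last lra.
  rewrite Q0 subr0 Q2pi.
  have fld (p q : R) : p != 0 -> (2 * p)^-1 * (2 * q) = q / p by move=> ?; field.
  by rewrite fld// gt_eqF.
pose P t := Q t - m * t.
have Pp : primitive P (fun t => psi t - m).
  apply: primitive_ext (primitiveB Qpsi (primitiveZ m (@primitive_id R))) => t.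
  by rewrite mulr1.
have P_le0 t : 0 <= t -> t <= pi -> P t <= 0.
  rewrite le_eqVlt => /predU1P[<- _|t0]; first by rewrite /P Q0 mulr0 subr0.
  rewrite le_eqVlt => /predU1P[->|tpi].
    by rewrite /P mE divfK ?subrr// gt_eqF.
  have := psi_avg t; rewrite t0 tpi => /(_ isT).
  rewrite (primitive_Rintegral cpsi Qpsi) ?(ltW t0)//.
  rewrite (primitive_Rintegral cpsi Qpsi) ?(ltW pi0)//.
  rewrite Q0 !subr0 mulrC ler_pdivrMr// => H.
  by rewrite /P mE subr_le0 [Q pi / pi]mulrC.
have NP : primitive (fun t => - P t) (fun t => - (psi t - m)) := primitiveN Pp.
have cNP := primitive_continuous NP.
have [G G0 GP] := exists_primitive cNP.
have NP_odd t : - P (- t) = - (- P t) by rewrite /P Q_odd; ring.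
have NP_per t : - P (t + 2 * pi) = - P t.
  have : m * pi = Q pi by rewrite mE divfK// gt_eqF.
  by rewrite /P Q_per Q2pi; lra.
have G_even := primitive_even NP_odd GP.
have G_per t : G (t + 2 * pi) = G t.
  have H := primitive_periodic NP_per GP G0.
  (* The function [- P] is odd and periodic, so it has mean zero over a period; evaluating at [- pi]
     and using that [G] is even gives this. *)
  suff G2 : G (2 * pi) = 0 by rewrite H G2 addr0.
  have := H (- pi); rewrite G_even (_ : - pi + 2 * pi = pi); last by ring.
  by move=> H'; lra.
have G_ndecr a b : 0 <= a -> a <= b -> b <= pi -> G a <= G b.
  move=> a0 ab bpi; apply: (primitive_le GP) => // t /andP[at_ tb].
  by rewrite oppr_ge0 P_le0 ?(le_trans a0)// (le_trans tb).
have [K K0 KG] := exists_primitive (primitive_continuous GP).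
have key := @unimodal_primitive_comparison _ G K G_even G_per G0 G_ndecr KG K0 (c * d / 7).
have cn0 : c != 0 by rewrite gt_eqF.
have g1 : primitive (fun t => c^-1 * P (c * t)) (fun t => psi (c * t) - m).
  by apply: primitive_ext (primitiveZ c^-1 (primitive_scale c Pp)) => t; rewrite mulKf.
(* As [G] is a primitive of [- P], the iterated primitives carry a minus sign. It turns the
   nonpositive combination of values of [K] into a nonnegative integral, and [G 0 = 0] removes the
   term from the slope of [Z] at 0. *)
have g2 : primitive (fun t => - c^-1 ^+ 2 * G (c * t)) (fun t => c^-1 * P (c * t)).
  apply: primitive_ext (primitiveZ (- c^-1 ^+ 2) (primitive_scale c GP)) => t.
  by field.
have g3 : primitive (fun t => - c^-1 ^+ 3 * K (c * t)) (fun t => - c^-1 ^+ 2 * G (c * t)).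
  apply: primitive_ext (primitiveZ (- c^-1 ^+ 3) (primitive_scale c KG)) => t.
  by field.
have cpsic : continuous (fun t => psi (c * t)).
  move=> t; apply: (@continuous_comp _ _ _ (fun t => c * t) psi); last exact: cpsi.
  by apply: cvgM; [exact: cvg_cst|exact: cvg_id].
have cpsim : continuous (fun t => psi (c * t) - m).
  by move=> t; apply: cvgB; [exact: cpsic|exact: cvg_cst].
have := Rintegral_Z d0 cpsim g1 g2 g3.
have -> : \int[lebesgue_measure]_(t in `[0, d]) ((psi (c * t) - m) * Z (t / d)) =
    47 / 1029 * (\int[mu]_(t in `[0, d]) (psi (c * t) * Vstar (t / d)) - m * d).
  under eq_Rintegral do rewrite mulrBl.
  rewrite RintegralB//; last 2 first.
  - by apply: continuous_integrable; exact: ZM_continuous.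
  - by apply: continuous_integrable; apply: ZM_continuous; exact: cst_continuous.
  rewrite Rintegral_Z_cst// mulrBr (mulrA _ m d); congr (_ - _).
  rewrite -RintegralZl//; last first.
    apply: (@continuous_integrable _ (fun t => psi (c * t) * Vstar (t / d))).
    rewrite (_ : (fun t => psi (c * t) * Vstar (t / d)) =
      fun t => psi (c * t) * (1029 / 47 * Z (t / d))); last first.
      by apply/funext => t; rewrite VstarE.
    move=> t; apply: cvgM; first exact: cpsic.
    apply: (@ZM_continuous _ (cst (1029 / 47)) d); exact: cst_continuous.
  by apply: eq_Rintegral => t _; rewrite VstarE; field.
rewrite mulr0 G0 !mulr0 addr0.
set r := c * d / 7 in key *.
have -> : c * (d / 7) = r by rewrite /r mulrA.
have -> : c * (5 * d / 7) = 5 * r by rewrite /r; ring.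
have -> : c * d = 7 * r by rewrite /r; field.
rewrite (_ : d ^- 2 * _ = d ^- 2 * c^-1 ^+ 3 * - (K r - 2 * K (5 * r) + K (7 * r))); last by ring.
move=> E.
have : 0 <= d ^- 2 * c^-1 ^+ 3 * - (K r - 2 * K (5 * r) + K (7 * r)).
  have /key : pi / 5 <= r by rewrite /r; lra.
  rewrite -oppr_ge0; apply: mulr_ge0.
  by rewrite mulr_ge0// ?invr_ge0 exprn_ge0// ?invr_ge0 ltW.
by rewrite -E => H; rewrite -subr_ge0; lra.
Qed.

End PsiClass.

(** * Weighted power means *)

Section WeightedMeans.
Context {R : realType}.
Implicit Types (f : R -> R) (z r q d A M : R).
Let mu := @lebesgue_measure R.

(** This is Young's inequality for the product [z * 1] with the conjugate exponents [r] and
    [r / (r - 1)]. *)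
Lemma bernoulli_powR z r : 0 <= z -> 1 <= r -> 1 + r * (z - 1) <= z `^ r.
Proof.
move=> z0; rewrite le_eqVlt => /predU1P[<-|r1]; first by rewrite powRr1//; lra.
have r0 : 0 < r by lra.
have rn0 : r != 0 by rewrite gt_eqF.
have r1n0 : r - 1 != 0 by rewrite gt_eqF// subr_gt0.
have q0 : 0 < r / (r - 1) by rewrite divr_gt0// subr_gt0.
have rq : r^-1 + (r / (r - 1))^-1 = 1 by rewrite invf_div; field.
have := conjugate_powR z0 ler01 r0 q0 rq.
rewrite powR1 mulr1 invf_div => h.
have : r * z <= r * (z `^ r / r + (1 - r^-1)).
  by rewrite ler_pM2l// (le_trans h)// lerD2l mul1r mulrBl divff// mul1r.
by rewrite mulrDr mulrCA mulfV// mulr1 mulrBr mulr1 mulfV//; lra.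
Qed.

Lemma Vstar_ge0 d t : 0 < d -> 0 <= t <= d -> 0 <= Vstar (t / d).
Proof.
move=> d0 /andP[t0 td]; rewrite VstarE; apply: mulr_ge0; first lra.
by apply: Z_ge0; rewrite divr_ge0 ?(ltW d0)//= ler_pdivrMr// mul1r.
Qed.

Lemma Vstar_continuous d : continuous (fun t : R => Vstar (t / d)).
Proof.
under eq_fun do rewrite VstarE.
apply: (@ZM_continuous _ (cst (1029 / 47)) d); exact: cst_continuous.
Qed.

Lemma Rintegral_Vstar d : 0 < d -> \int[mu]_(t in `[0, d]) Vstar (t / d) = d.
Proof.
move=> d0; under eq_Rintegral do rewrite VstarE.
by rewrite Rintegral_Z_cst//; field.
Qed.

Lemma itv_bounded_integrable f d M : measurable_fun setT f ->
  (forall t, 0 <= t <= d -> `|f t| <= M) -> mu.-integrable `[0, d] (EFin \o f).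
Proof.
move=> mf fM; apply: measurable_bounded_integrable => //.
- by rewrite /= lebesgue_measure_itv; case: ifP => //=; rewrite ltry.
- exact: measurable_funTS.
- exists M; split; first exact: num_real.
  move=> N MN t /=; rewrite in_itv/= => /fM/le_trans; apply; exact: ltW.
Qed.

Lemma itv_weighted_integrable f d M : 0 < d -> measurable_fun setT f ->
  (forall t, 0 <= f t <= M) ->
  mu.-integrable `[0, d] (EFin \o (fun t => f t * Vstar (t / d))).
Proof.
move=> d0 mf fM.
have [c _ cP] := EVT_max (ltW d0) (continuous_subspaceT (@Vstar_continuous d)).
apply: (@itv_bounded_integrable _ d (M * Vstar (c / d))).
  by apply: measurable_funM => //; apply: continuous_measurable_fun; exact: Vstar_continuous.
move=> t td; have /andP[f0 fM'] := fM t.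
have V0 := Vstar_ge0 d0 td.
rewrite ger0_norm; last exact: mulr_ge0.
by apply: ler_pM => //; apply: cP; rewrite in_itv.
Qed.

(** Jensen's inequality in tangent-line form: [w^(q/2)] lies above its tangent at [w = A].
    Integrating at [w = f t ^+ 2] against the weight, of total mass [d], and using that the slope is
    nonnegative gives the bound. *)
Lemma weighted_power_mean f d A q M : 0 < d -> 0 < A -> 2 <= q ->
  (forall t, 0 <= f t <= M) -> measurable_fun setT (fun t => f t ^+ 2) ->
  A * d <= \int[mu]_(t in `[0, d]) (f t ^+ 2 * Vstar (t / d)) ->
  Num.sqrt A <= (d^-1 * \int[mu]_(t in `[0, d]) (f t `^ q * Vstar (t / d))) `^ q^-1.
Proof.
move=> d0 A0 q2 fM mf2 HA.
have r1 : 1 <= q / 2 by lra.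
have An0 : A != 0 by rewrite gt_eqF.
have f0 t : 0 <= f t by case/andP: (fM t).
have fq t : f t `^ q = (f t ^+ 2) `^ (q / 2).
  by rewrite -powR_mulrn// -powRrM mulrCA divff// mulr1.
set J := \int[mu]_(t in _) (f t `^ q * _).
have AJ : A `^ (q / 2) <= d^-1 * J.
  rewrite [leRHS]mulrC ler_pdivlMr//.
  have i1 : mu.-integrable `[0, d] (EFin \o (fun t => f t `^ q * Vstar (t / d))).
    apply: (@itv_weighted_integrable (fun t => f t `^ q) d (M `^ q)) => //.
      under eq_fun do rewrite fq.
      exact: measurableT_comp (measurable_powR _) mf2.
    move=> t; rewrite powR_ge0/= ge0_ler_powR ?nnegrE//; [lra| |].
      by have /andP[] := fM t; exact: le_trans.
    by have /andP[] := fM t.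
  have i2 : mu.-integrable `[0, d] (EFin \o (fun t => f t ^+ 2 * Vstar (t / d))).
    apply: (@itv_weighted_integrable (fun t => f t ^+ 2) d (M ^+ 2)) => // t.
    rewrite sqr_ge0/=; have /andP[h1 h2] := fM t.
    by rewrite lerXn2r ?nnegrE// (le_trans h1).
  have i3 : mu.-integrable `[0, d] (EFin \o (fun t => Vstar (t / d))).
    by apply: continuous_integrable; exact: Vstar_continuous.
  (* The tangent at [A] is [b * w + a], with [b * A + a = A^(q/2)]. *)
  pose a := A `^ (q / 2) * (1 - q / 2); pose b := A `^ (q / 2) * (q / 2 / A).
  have i2b : mu.-integrable `[0, d] (EFin \o (fun t => b * (f t ^+ 2 * Vstar (t / d)))).
    by apply: (integrableZl _ b i2).
  have i3a : mu.-integrable `[0, d] (EFin \o (fun t => a * Vstar (t / d))).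
    by apply: (integrableZl _ a i3).
  have : \int[mu]_(t in `[0, d]) (b * (f t ^+ 2 * Vstar (t / d)) + a * Vstar (t / d)) <= J.
    apply: le_Rintegral => //.
      by apply: (integrableD _ i2b i3a).
    move=> t /=; rewrite in_itv/= => td.
    rewrite mulrA -mulrDl ler_wpM2r ?Vstar_ge0// fq.
    have z0 : 0 <= f t ^+ 2 / A by rewrite divr_ge0 ?sqr_ge0 ?ltW.
    rewrite -[X in _ <= X `^ _](divfK An0).
    rewrite powRM ?(ltW A0)// [leRHS]mulrC.
    have := bernoulli_powR z0 r1; rewrite -(ler_pM2l (powR_gt0 (q / 2) A0)).
    apply: le_trans; rewrite /a /b le_eqVlt; apply/orP; left; apply/eqP; ring.
  rewrite RintegralD// !RintegralZl// Rintegral_Vstar//.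
  apply: le_trans.
  have b0 : 0 <= b by rewrite mulr_ge0 ?powR_ge0// divr_ge0 ?ltW//; lra.
  have := ler_wpM2l b0 HA; rewrite -(lerD2r (a * d)); apply: le_trans.
  by rewrite le_eqVlt /a /b; apply/orP; left; apply/eqP; field.
rewrite -powR12_sqrt ?(ltW A0)//.
have -> : A `^ 2^-1 = (A `^ (q / 2)) `^ q^-1.
  by rewrite -powRrM mulrAC divff ?mul1r// gt_eqF//; lra.
apply: ge0_ler_powR; rewrite ?nnegrE ?powR_ge0 ?invr_ge0//; first lra.
exact: le_trans (powR_ge0 _ _) AJ.
Qed.

Lemma weighted_sup_mean f d A M : 0 < d -> 0 < A ->
  (forall t, 0 <= f t <= M) -> measurable_fun setT (fun t => f t ^+ 2) ->
  A * d <= \int[mu]_(t in `[0, d]) (f t ^+ 2 * Vstar (t / d)) ->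
  Num.sqrt A <= sup [set f t | t in `[0, d]].
Proof.
move=> d0 A0 fM mf2 HA.
set S := sup _.
have fS t : 0 <= t <= d -> f t <= S.
  move=> td; apply: ub_le_sup.
    by exists M => _ [s _ <-]; case/andP: (fM s).
  by exists t => //; rewrite /= in_itv.
have f0 t : 0 <= f t by case/andP: (fM t).
have S0 : 0 <= S by apply: le_trans (f0 0) (fS _ _); rewrite lexx ltW.
rewrite -(ger0_norm S0) -sqrtr_sqr ler_sqrt ?sqr_ge0//.
rewrite -(ler_pM2r d0) (le_trans HA)//.
rewrite -[in leRHS](Rintegral_Vstar d0) -RintegralZl//; last first.
  by apply: continuous_integrable; exact: Vstar_continuous.
apply: le_Rintegral => //.
- apply: (@itv_weighted_integrable (fun t => f t ^+ 2) d (M ^+ 2)) => // t.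
  rewrite sqr_ge0/=; have /andP[h1 h2] := fM t.
  by rewrite lerXn2r ?nnegrE// (le_trans h1).
- apply: (@continuous_integrable _ (fun t => S ^+ 2 * Vstar (t / d))) => t.
  by apply: cvgM; [exact: cvg_cst|exact: Vstar_continuous].
- move=> t /=; rewrite in_itv/= => td.
  by rewrite ler_wpM2r ?Vstar_ge0// lerXn2r ?nnegrE// fS.
Qed.

End WeightedMeans.

(** * Spectral integrals *)

Section RealNorm.
Context {R : realType}.

Lemma normC_rnorm (V : normedZmodType R[i]) (v : V) : `|v| = (rnorm v)%:C.
Proof.
by rewrite /rnorm; have := normr_ge0 v; case: `|v| => a b; rewrite lecE/= => /andP[/eqP ->].
Qed.

Lemma rnorm_ge0 (V : normedZmodType R[i]) (v : V) : 0 <= rnorm v.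
Proof. by have := normr_ge0 v; rewrite normC_rnorm lecE/= => /andP[]. Qed.

Lemma rnorm0 (V : normedZmodType R[i]) : rnorm (0 : V) = 0.
Proof. by rewrite /rnorm normr0. Qed.

Lemma rnorm_distC (V : normedZmodType R[i]) (u v : V) : rnorm (u - v) = rnorm (v - u).
Proof. by rewrite /rnorm distrC. Qed.

Lemma ler_rnormD (V : normedZmodType R[i]) (u v : V) :
  rnorm (u + v) <= rnorm u + rnorm v.
Proof. by have := ler_normD u v; rewrite !normC_rnorm -rmorphD/= lecR. Qed.

Lemma ler_rnorm_dist (V : normedZmodType R[i]) (u v : V) :
  `|rnorm u - rnorm v| <= rnorm (u - v).
Proof.
rewrite ler_norml lerBlDr lerNl opprB lerBlDr.
apply/andP; split; last by rewrite -{1}[u](subrK v) ler_rnormD.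
by rewrite rnorm_distC -{1}[v](subrK u) ler_rnormD.
Qed.

Lemma rnorm_eq0 (V : normedZmodType R[i]) (v : V) : rnorm v = 0 -> v = 0.
Proof. by move=> v0; apply/eqP; rewrite -normr_eq0 normC_rnorm v0. Qed.

Lemma rnormZ (V : normedModType R[i]) (c : R[i]) (v : V) :
  rnorm (c *: v) = rnorm c * rnorm v.
Proof.
by apply: complexI; rewrite -normC_rnorm normrZ !normC_rnorm rmorphM.
Qed.

Lemma ler_rnorm_ReIm (z : R[i]) : rnorm z <= `|complex.Re z| + `|complex.Im z|.
Proof.
case: z => a b /=; rewrite /rnorm normc_def/=.
rewrite -(@ler_pXn2r _ 2)// ?nnegrE ?sqrtr_ge0 ?addr_ge0//.
rewrite sqr_sqrtr ?addr_ge0 ?sqr_ge0//.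
rewrite sqrrD !real_normK ?num_real// -addrA lerD2l lerDr.
by rewrite mulrn_wge0// mulr_ge0.
Qed.

Lemma ler_Re_rnorm (z : R[i]) : `|complex.Re z| <= rnorm z.
Proof.
case: z => a b /=; rewrite /rnorm normc_def/= -sqrtr_sqr.
by rewrite ler_sqrt ?lerDl ?addr_ge0 ?sqr_ge0.
Qed.

Lemma ler_Im_rnorm (z : R[i]) : `|complex.Im z| <= rnorm z.
Proof.
case: z => a b /=; rewrite /rnorm normc_def/= -sqrtr_sqr.
by rewrite ler_sqrt ?lerDr ?addr_ge0 ?sqr_ge0.
Qed.

Lemma gt0_complexE (e : R[i]) : 0 < e -> e = (complex.Re e)%:C /\ 0 < complex.Re e.
Proof.
case: e => a b; rewrite ltcE/= => /andP[/eqP -> a0]; split => //.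
Qed.

(** A positive element of [R[i]] is real, so convergence can be tested with real tolerances. *)
Lemma cvg_rnormP (V : normedModType R[i]) (u : nat -> V) (l : V) :
  (u @ \oo --> l) <->
  (forall e : R, 0 < e -> \forall n \near \oo, rnorm (u n - l) < e).
Proof.
split=> [/cvgrPdist_lt ul e e0|ul].
  have eC : 0 < e%:C :> R[i] by rewrite ltcR.
  apply: filterS (ul _ eC) => n.
  by rewrite normC_rnorm ltcR rnorm_distC.
apply/cvgrPdist_lt => e e0.
have [eE /ul] := gt0_complexE e0; apply: filterS => n.
by rewrite [e]eE normC_rnorm ltcR rnorm_distC.
Qed.

Lemma cvg_rnorm (V : normedModType R[i]) (u : nat -> V) (l : V) :
  u @ \oo --> l -> (fun n => rnorm (u n)) @ \oo --> rnorm l.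
Proof.
move=> /cvg_rnormP ul; apply/cvgrPdist_lt => e /ul; apply: filterS => n.
by rewrite distrC; apply: le_lt_trans; exact: ler_rnorm_dist.
Qed.

Lemma rcauchy_cvg (V : completeNormedModType R[i]) (u : nat -> V) :
  (forall e : R, 0 < e -> exists N : nat,
    forall m n, (N <= m)%N -> (N <= n)%N -> rnorm (u m - u n) < e) ->
  cvg (u @ \oo).
Proof.
move=> uC; apply/cauchy_cvgP/cauchy_exP => e e0.
have [eE /uC[N uN]] := gt0_complexE e0.
exists (u N); exists N => // n /= Nn.
by rewrite -ball_normE/= eE normC_rnorm ltcR uN.
Qed.

End RealNorm.

Section Spectral.
Context {R : realType} {H : completeNormedModType R[i]}.
Variables (dot : {dot H for @Num.conj R[i]}) (E : set R -> H -> H).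
Hypotheses (Hdot : norm_from_dot dot) (HE : resolution_of_identity dot E).

Lemma sqr_rnormE (v : H) : (rnorm v ^+ 2)%:C = dot v v.
Proof. by rewrite rmorphXn/= -normC_rnorm Hdot. Qed.

Lemma dot_eq0C (u v : H) : dot u v = 0 -> dot v u = 0.
Proof.
move=> uv0; transitivity ((-1) ^+ false * Num.conj (dot u v)); first exact: hermC.
by rewrite uv0 rmorph0 mulr0.
Qed.

Lemma sqr_rnormD (u v : H) : dot u v = 0 ->
  rnorm (u + v) ^+ 2 = rnorm u ^+ 2 + rnorm v ^+ 2.
Proof.
by move=> uv0; apply: complexI; rewrite rmorphD/= !sqr_rnormE (hnormDd (form := dot) uv0).
Qed.

Lemma projection_sqr_rnorm P x : orthogonal_projection dot P ->
  (rnorm (P x) ^+ 2)%:C = dot (P x) x.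
Proof. by move=> [_ Pid Psa]; rewrite sqr_rnormE Psa Pid -Psa. Qed.

Lemma projection_contract P x : orthogonal_projection dot P ->
  rnorm (P x) ^+ 2 <= rnorm x ^+ 2.
Proof.
move=> oP; have Px0 : dot (P x) (x - P x) = 0.
  by rewrite linearBr/= -(projection_sqr_rnorm _ oP) sqr_rnormE subrr.
by rewrite -{2}[x](subrK (P x)) addrC (sqr_rnormD Px0) lerDl sqr_ge0.
Qed.

(** Finite additivity follows by padding the pair with empty sets: the partial sums are constant
    from index 2 on. *)
Lemma roi_setU A B x : measurable A -> measurable B -> A `&` B = set0 ->
  E (A `|` B) x = E A x + E B x.
Proof.
move=> mA mB AB0.
have mAB n : measurable (bigcup2 A B n) by case: n => [|[|n]] //=.
have := roi_sigma_additive HE mAB.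
rewrite -trivIset_bigcup2 bigcup2E => /(_ AB0 x).
move=> /(cvg_unique (@norm_hausdorff _ _)); apply.
have : (fun n => series (fun n => E (bigcup2 A B n) x) (n + 2)%N) @ \oo --> E A x + E B x.
  rewrite (_ : (fun n => _) = cst (E A x + E B x)); first exact: cvg_cst.
  apply/funext => n; rewrite /series/= addn2 big_nat_recl// big_nat_recl//=.
  by rewrite big1 ?addr0// => i _; rewrite (roi_set0 HE).
by rewrite cvg_shiftn.
Qed.

(** Multiplicativity of [E] is not among the axioms. Applied to [E A x], the projection on the union
    has squared norm equal to that of [E A x] plus that of [E B (E A x)]; being a contraction, it
    forces the second term to vanish. *)
Lemma roi_ortho_comp A B x : measurable A -> measurable B -> A `&` B = set0 ->
  E B (E A x) = 0.
Proof.
move=> mA mB AB0; have mAB := measurableU _ _ mA mB.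
have pA := roi_proj HE mA; have pB := roi_proj HE mB; have pAB := roi_proj HE mAB.
have EA : E A (E A x) = E A x by case: pA => _ ->.
have H1 : rnorm (E (A `|` B) (E A x)) ^+ 2 =
          rnorm (E A x) ^+ 2 + rnorm (E B (E A x)) ^+ 2.
  apply: complexI; rewrite (projection_sqr_rnorm _ pAB) roi_setU// linearDl/=.
  by rewrite -!projection_sqr_rnorm// EA rmorphD.
have := projection_contract (E A x) pAB; rewrite H1 gerDl => H2.
by apply: rnorm_eq0; apply/eqP; rewrite -sqrf_eq0 eq_le H2 sqr_ge0.
Qed.

Lemma roi_ortho A B x : measurable A -> measurable B -> A `&` B = set0 ->
  dot (E A x) (E B x) = 0.
Proof.
move=> mA mB AB0; have [_ _ sB] := roi_proj HE mB.
by apply: dot_eq0C; rewrite sB roi_ortho_comp// linear0r.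
Qed.

(** * Simple functions written as [k \o q] over the fibres of one finite-valued map [q] *)

Section Fibres.
Variables (T : choiceType) (q : R -> T).
Hypothesis mq : forall p, measurable (q @^-1` [set p]).

Let fib p := q @^-1` [set p].

Lemma fib_disj p p' : p != p' -> fib p `&` fib p' = set0.
Proof.
move=> pp'; apply/seteqP; split => // t [tp tp']; move: pp'.
by rewrite -(tp : q t = p) (tp' : q t = p') eqxx.
Qed.

Lemma preimage_seq_cons p r :
  q @^-1` [set` p :: r] = fib p `|` q @^-1` [set` r].
Proof.
apply/seteqP; split => t /=; rewrite inE; first by move=> /orP[/eqP|]; [left|right].
by move=> [tp|->]; [rewrite (tp : q t = p) eqxx|rewrite orbT].
Qed.

Lemma measurable_fib_seq (r : seq T) : measurable (q @^-1` [set` r]).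
Proof.
elim: r => [|p r IH]; first by rewrite set_nil preimage_set0; exact: measurable0.
by rewrite preimage_seq_cons; apply: measurableU => //; exact: mq.
Qed.

Lemma roi_fib_seq (r : seq T) x : uniq r ->
  E (q @^-1` [set` r]) x = \sum_(p <- r) E (fib p) x.
Proof.
elim: r => [_|p r IH /= /andP[pr ur]].
  by rewrite big_nil set_nil preimage_set0; exact: (roi_set0 HE).
rewrite big_cons -IH// preimage_seq_cons roi_setU//; [exact: mq| |].
  exact: measurable_fib_seq.
apply/seteqP; split => // t [/= tp]; rewrite (tp : q t = p) => rp.
by move: pr; rewrite rp.
Qed.

Lemma sqr_rnorm_fib_sum (r : seq T) (k : T -> R[i]) x : uniq r ->
  rnorm (\sum_(p <- r) k p *: E (fib p) x) ^+ 2 =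
  \sum_(p <- r) rnorm (k p) ^+ 2 * rnorm (E (fib p) x) ^+ 2.
Proof.
elim: r => [_|p r IH /= /andP[pr ur]]; first by rewrite !big_nil rnorm0 expr0n.
rewrite !big_cons sqr_rnormD; first by rewrite IH// rnormZ exprMn.
rewrite linearZl_LR linear_sumr/= big_seq big1 ?scaler0 ?mulr0// => p' p'r.
have pp' : p != p' by apply: contraNneq pr => ->.
by rewrite linearZr_LR/= (roi_ortho x (mq p) (mq p') (fib_disj pp')) mulr0.
Qed.

Variable r : seq T.
Hypotheses (ur : uniq r) (qr : forall t, q t \in r).

Lemma preimage_comp_fib (k : T -> R[i]) c :
  (k \o q) @^-1` [set c] = q @^-1` [set` [seq p <- r | k p == c]].
Proof.
apply/seteqP; split => t /=; rewrite mem_filter.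
  by move=> ->; rewrite eqxx qr.
by move=> /andP[/eqP].
Qed.

Lemma simple_function_comp (k : T -> R[i]) : simple_function (k \o q).
Proof.
split=> [|c]; last by rewrite preimage_comp_fib; exact: measurable_fib_seq.
apply: (@sub_finite_set _ _ [set` map k r]); last exact: finite_seq.
by move=> _ [t _ <-]/=; rewrite map_f.
Qed.

(** The map [k] may identify fibres: each level set of [k \o q] is split into the fibres that it
    contains and the double sum is exchanged. Values that are listed but not attained contribute
    [E set0 x = 0]. *)
Lemma simple_integral_comp (k : T -> R[i]) x :
  simple_integral E (k \o q) x = \sum_(p <- r) k p *: E (fib p) x.
Proof.
pose rc := undup (map k r).
rewrite /simple_integral (@fsbig_widen _ _ _ _ _ [set` rc]); last 2 first.
- by move=> _ [t _ <-] /=; rewrite mem_undup map_f.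
- move=> c /= [_ nc]; rewrite (_ : _ @^-1` _ = set0) ?(roi_set0 HE) ?scaler0//.
  by apply/seteqP; split => t //= tc; apply: nc; exists t.
rewrite -fsbig_seq ?undup_uniq//.
under eq_bigr => c _.
  rewrite preimage_comp_fib roi_fib_seq ?filter_uniq// big_filter scaler_sumr big_mkcond/=.
  over.
rewrite exchange_big/=; apply: eq_big_seq => p pr.
rewrite (bigD1_seq (k p)) ?undup_uniq ?mem_undup ?map_f//= eqxx.
by rewrite big1 ?addr0// => c; rewrite eq_sym => /negPf ->.
Qed.

Lemma sqr_rnorm_simple_comp (k : T -> R[i]) x :
  rnorm (simple_integral E (k \o q) x) ^+ 2 =
  \sum_(p <- r) rnorm (k p) ^+ 2 * rnorm (E (fib p) x) ^+ 2.
Proof. by rewrite simple_integral_comp sqr_rnorm_fib_sum. Qed.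

Lemma sum_sqr_fib x : \sum_(p <- r) rnorm (E (fib p) x) ^+ 2 = rnorm x ^+ 2.
Proof.
rewrite -[in RHS](roi_setT HE x) (_ : setT = q @^-1` [set` r]); last first.
  by apply/seteqP; split => t // _; exact: qr.
rewrite roi_fib_seq// (_ : \sum_(p <- r) E (fib p) x =
  \sum_(p <- r) (1 : R[i]) *: E (fib p) x); last first.
  by apply: eq_bigr => p _; rewrite scale1r.
rewrite (sqr_rnorm_fib_sum (fun=> 1))//; apply: eq_bigr => p _.
by rewrite /rnorm normr1 /= expr1n mul1r.
Qed.

End Fibres.

Lemma simple_range (s : R -> R[i]) : simple_function s ->
  exists2 r : seq R[i], uniq r & forall t, s t \in r.
Proof.
move=> [/finite_seqP[r rE] _]; exists (undup r); first exact: undup_uniq.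
by move=> t; rewrite mem_undup; have : range s (s t) by []; rewrite rE.
Qed.

(** Pairing the two functions puts them on a common partition, where orthogonality bounds the
    difference term by term. This Lipschitz estimate yields both uniqueness and existence of the
    spectral integral. *)
Lemma simple_integral_dist (s s' : R -> R[i]) (e : R) x :
  simple_function s -> simple_function s' -> 0 <= e ->
  (forall t, rnorm (s t - s' t) <= e) ->
  rnorm (simple_integral E s x - simple_integral E s' x) <= e * rnorm x.
Proof.
move=> ss ss' e0 se.
have [r ur sr] := simple_range ss; have [r' ur' sr'] := simple_range ss'.
pose q t := (s t, s' t).
pose rr := [seq (a, b) | a <- r, b <- r'].
have urr : uniq rr by apply: allpairs_uniq => // -[a b] [c d].
have qr t : q t \in rr by apply: allpairs_f.
have mq p : measurable (q @^-1` [set p]).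
  have [_ ms] := ss; have [_ ms'] := ss'.
  rewrite (_ : _ @^-1` _ = s @^-1` [set p.1] `&` s' @^-1` [set p.2]).
    exact: measurableI.
  by apply/seteqP; split => t /=; [move=> <-|case: p => a b /= [<- <-]].
have -> : simple_integral E s x = simple_integral E (fst \o q) x by [].
have -> : simple_integral E s' x = simple_integral E (snd \o q) x by [].
rewrite !(simple_integral_comp mq urr qr) -sumrB.
under eq_bigr do rewrite -scalerBl.
rewrite -(@ler_pXn2r _ 2)// ?nnegrE ?mulr_ge0 ?rnorm_ge0//.
rewrite (sqr_rnorm_fib_sum mq (fun p => p.1 - p.2))// exprMn -(sum_sqr_fib mq urr qr).
rewrite mulr_sumr; apply: ler_sum => p _.
(* The list [rr] may contain pairs that are never attained; the bound by [e] says nothing about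
   them, but their fibre is empty. *)
have [[t tp]|np] := pselect (exists t, q t = p).
  by rewrite ler_wpM2r ?sqr_ge0// lerXn2r ?nnegrE ?rnorm_ge0// -tp; exact: se.
rewrite (_ : q @^-1` [set p] = set0); last first.
  by apply/seteqP; split => t //= tp; apply: np; exists t.
by rewrite (roi_set0 HE) rnorm0 expr0n !mulr0.
Qed.

(** Independence of the approximating sequence is what makes the value chosen by [xget]
    meaningful. *)
Lemma spectral_integral_unique (f : R -> R[i]) x y y' :
  is_spectral_integral E f x y -> is_spectral_integral E f x y' -> y = y'.
Proof.
move=> [s [ss sf sy]] [s' [ss' sf' sy']].
apply/eqP; rewrite -subr_eq0; apply/eqP/rnorm_eq0/eqP.
rewrite eq_le rnorm_ge0 andbT; apply/ler_addgt0Pr => e e0; rewrite add0r.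
(* Adding 1 keeps the tolerance well defined when [x = 0]; two such errors, multiplied by [rnorm x],
   cost at most [e / 2]. *)
have e4 : 0 < e / 4 / (rnorm x + 1).
  by rewrite !divr_gt0// ltr_wpDl ?rnorm_ge0.
have e4' : 0 < e / 4 by rewrite divr_gt0.
near \oo => n.
have d0 : rnorm (simple_integral E (s n) x - y) < e / 4.
  by near: n; move/cvg_rnormP : sy; exact.
have d1 : rnorm (simple_integral E (s' n) x - y') < e / 4.
  by near: n; move/cvg_rnormP : sy'; exact.
have d2 : rnorm (simple_integral E (s n) x - simple_integral E (s' n) x) <=
    (2 * (e / 4 / (rnorm x + 1))) * rnorm x.
  apply: simple_integral_dist => //; first by rewrite mulr_ge0// ltW.
  have h1 : forall t, rnorm (s n t - f t) < e / 4 / (rnorm x + 1).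
    by near: n; exact: sf.
  have h2 : forall t, rnorm (s' n t - f t) < e / 4 / (rnorm x + 1).
    by near: n; exact: sf'.
  move=> t; rewrite mulrDl !mul1r -[s n t](subrK (f t)) -addrA.
  by rewrite (le_trans (ler_rnormD _ _))// lerD ?(ltW (h1 t))// rnorm_distC (ltW (h2 t)).
have d3 : 2 * (e / 4 / (rnorm x + 1)) * rnorm x <= e / 2.
  have := rnorm_ge0 x; move: (rnorm x) => a a0.
  rewrite (_ : _ * a = e / 2 * (a / (a + 1))); last by field; lra.
  by apply: ler_piMr; [lra|rewrite ler_pdivrMr; lra].
set a := simple_integral E (s n) x in d0 d2; set b := simple_integral E (s' n) x in d1 d2.
have -> : y - y' = (y - a) + ((a - b) + (b - y')).
  by rewrite addrA [y - a + _]addrA subrK addrA subrK.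
have := ler_rnormD (y - a) ((a - b) + (b - y')).
have := ler_rnormD (a - b) (b - y').
by move: d0; rewrite rnorm_distC; lra.
Unshelve. all: by end_near. Qed.


End Spectral.

(** * The scalar measure attached to a vector, and the isometry *)

Section SpectralMeasure.
Context {R : realType} {H : completeNormedModType R[i]}.
Variables (dot : {dot H for @Num.conj R[i]}) (E : set R -> H -> H).
Hypotheses (Hdot : norm_from_dot dot) (HE : resolution_of_identity dot E).

Lemma sqr_rnorm_series (B : (set R)^nat) x n :
  (forall n, measurable (B n)) -> trivIset setT B ->
  rnorm (series (fun n => E (B n) x) n) ^+ 2 =
  \sum_(0 <= i < n) rnorm (E (B i) x) ^+ 2.
Proof.
move=> mB tB; rewrite /series/=; elim: n => [|n IH].
  by rewrite !big_geq// rnorm0 expr0n.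
rewrite !big_nat_recr//= (sqr_rnormD Hdot) ?IH//.
rewrite linear_sumlz big_nat big1// => i /andP[_ iltn].
apply: (roi_ortho Hdot HE) => //.
by move/trivIsetP : tB => /(_ i n Logic.I Logic.I); apply; rewrite ltn_eqF.
Qed.

(** Countable additivity comes from the strong convergence of the series: by orthogonality the
    squared norm of a partial sum is the sum of the squared norms, and the norm is continuous. *)
Lemma exists_spectral_measure x :
  exists mu : {finite_measure set R -> \bar R}, forall B, mu B = (rnorm (E B x) ^+ 2)%:E.
Proof.
pose f (B : set R) : \bar R := (rnorm (E B x) ^+ 2)%:E.
have f0 : f set0 = 0%E by rewrite /f (roi_set0 HE) rnorm0 expr0n.
have fge0 B : (0 <= f B)%E by rewrite lee_fin sqr_ge0.
have fsigma : semi_sigma_additive f.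
  move=> F mF tF mUF.
  rewrite (_ : (fun n => _) =
    EFin \o (fun n => rnorm (series (fun n => E (F n) x) n) ^+ 2)); last first.
    by apply/funext => n /=; rewrite sqr_rnorm_series// -sumEFin.
  have h := cvg_rnorm (@roi_sigma_additive _ _ _ _ HE F mF tF x).
  apply/fine_cvgP; split; first exact: nearW.
  exact: (cvgM h h).
pose mu : {measure set R -> \bar R} :=
  HB.pack f (isMeasure.Build _ _ _ f f0 fge0 fsigma).
have ffin : fin_num_fun mu by [].
pose nu : {finite_measure set R -> \bar R} :=
  HB.pack (mu : set R -> \bar R) mu (Measure_isFinite.Build _ _ _ mu ffin).
by exists nu.
Qed.

Section Isometry.
Variables (x : H) (mu : {measure set R -> \bar R}).
Hypothesis muE : forall B, mu B = (rnorm (E B x) ^+ 2)%:E.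

Lemma simple_integral_isometry (s : R -> R[i]) : simple_function s ->
  (rnorm (simple_integral E s x) ^+ 2)%:E = (\int[mu]_t (rnorm (s t) ^+ 2)%:E)%E.
Proof.
move=> ss; have [r ur sr] := simple_range ss; have [_ ms] := ss.
have -> : simple_integral E s x = simple_integral E (id \o s) x by [].
rewrite (sqr_rnorm_simple_comp Hdot HE ms ur sr) -sumEFin.
transitivity (\int[mu]_t
    \sum_(p <- r) ((rnorm p ^+ 2)%:E * (\1_(s @^-1` [set p]) t)%:E))%E; last first.
  apply: eq_integral => t _; rewrite (bigD1_seq (s t))//= big1 ?adde0.
    by rewrite indicE mem_set// mule1.
  by move=> p; rewrite indicE => /eqP pst; rewrite memNset ?mule0// => /= /esym.
rewrite ge0_integral_sum//.
- apply: eq_bigr => p _; rewrite ge0_integralZl_EFin ?sqr_ge0//.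
  + by rewrite integral_indic// setIT muE EFinM.
  + exact/measurable_EFinP.
- by move=> p; apply: measurable_funeM; exact/measurable_EFinP.
- by move=> p t _; rewrite mule_ge0// lee_fin ?sqr_ge0.
Qed.

Lemma measurable_sqr_simple (s : R -> R[i]) : simple_function s ->
  measurable_fun setT (fun t => (rnorm (s t) ^+ 2)%:E).
Proof.
move=> ss; have [r ur sr] := simple_range ss; have [_ ms] := ss.
rewrite (_ : (fun t => _) = fun t =>
    (\sum_(p <- r) ((rnorm p ^+ 2)%:E * (\1_(s @^-1` [set p]) t)%:E))%E).
  by apply: emeasurable_sum => p; apply: measurable_funeM; exact/measurable_EFinP.
apply/funext => t; rewrite (bigD1_seq (s t))//= big1 ?adde0.
  by rewrite indicE mem_set// mule1.
by move=> p; rewrite indicE => /eqP pst; rewrite memNset ?mule0// => /= /esym.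
Qed.

Lemma spectral_mu_setT : mu setT = (rnorm x ^+ 2)%:E.
Proof. by rewrite muE (roi_setT HE). Qed.

(** The isometry for simple functions passes to the limit on the vector side by continuity of the
    norm, and on the scalar side by dominated convergence with a constant majorant, integrable
    because [mu] is finite. *)
Lemma spectral_integral_isometry (f : R -> R[i]) y M :
  is_spectral_integral E f x y -> (forall t, rnorm (f t) <= M) ->
  (rnorm y ^+ 2)%:E = (\int[mu]_t (rnorm (f t) ^+ 2)%:E)%E.
Proof.
move=> [s [ss sf sy]] fM.
(* From index [N] on the approximants stay within 1 of [f], hence the majorant [(M + 1) ^+ 2] for
   the shifted sequence. *)
have [N _ sN] := sf 1 ltr01.
pose u n t := (rnorm (s (n + N)%N t) ^+ 2)%:E.
have uf : (fun n => \int[mu]_t u n t)%E @ \oo --> (\int[mu]_t (rnorm (f t) ^+ 2)%:E)%E.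
  apply: (@dominated_cvg _ _ _ mu setT measurableT _ (fun t => (rnorm (f t) ^+ 2)%:E)
    (cst ((M + 1) ^+ 2)%:E)) => //.
  - by move=> n; exact: measurable_sqr_simple.
  - move=> t _; apply/fine_cvgP; split; first exact: nearW.
    have st : (fun n => rnorm (s (n + N)%N t)) @ \oo --> rnorm (f t).
      apply/cvgrPdist_lt => e /sf [K _ sK]; exists K => // n /= Kn.
      rewrite distrC (le_lt_trans (ler_rnorm_dist _ _))//.
      by apply: sK => /=; rewrite (leq_trans Kn)// leq_addr.
    exact: (cvgM st st).
  - apply/integrableP; split; first exact: measurable_cst.
    by rewrite integral_cst// spectral_mu_setT -EFinM ltry.
  - move=> n t _; rewrite /u/= ger0_norm ?sqr_ge0// lee_fin.
    have M0 : 0 <= M := le_trans (rnorm_ge0 _) (fM t).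
    rewrite lerXn2r ?nnegrE ?rnorm_ge0 ?addr_ge0//.
    rewrite -[s _ t](subrK (f t)) addrC (le_trans (ler_rnormD _ _))// lerD// ltW//.
    by apply: sN; rewrite /= leq_addl.
have uy : (fun n => \int[mu]_t u n t)%E @ \oo --> (rnorm y ^+ 2)%:E.
  under eq_fun do rewrite -simple_integral_isometry//.
  apply/fine_cvgP; split; first exact: nearW.
  have h : (fun n => rnorm (simple_integral E (s (n + N)%N) x)) @ \oo --> rnorm y.
    have := cvg_rnorm sy.
    by rewrite -(cvg_shiftn N).
  exact: (cvgM h h).
exact: cvg_unique uy uf.
Qed.

End Isometry.

End SpectralMeasure.

(** * Existence of spectral integrals of bounded measurable functions, and the bound on the best
    approximation *)

Section Existence.
Context {R : realType} {H : completeNormedModType R[i]}.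
Variables (dot : {dot H for @Num.conj R[i]}) (E : set R -> H -> H).
Hypotheses (Hdot : norm_from_dot dot) (HE : resolution_of_identity dot E).

Lemma measurable_floor_fib (g : R -> R) k : measurable_fun setT g ->
  measurable ((fun t => Num.floor (g t)) @^-1` [set k]).
Proof.
move=> mg; rewrite (_ : _ @^-1` _ = g @^-1` `[k%:~R, (k + 1)%:~R[).
  by rewrite -[_ @^-1` _]setTI; apply: mg => //; exact: measurable_itv.
apply/seteqP; split => t /=; rewrite in_itv/=.
  by move=> <-; exact: Num.Theory.floor_itv.
exact: Num.Theory.floor_def.
Qed.

Lemma floor_range (M : R) : exists2 r : seq int, uniq r &
  forall y : R, `|y| <= M -> Num.floor y \in r.
Proof.
have [K MK] : exists K : nat, M < K%:R.
  exists (Num.Def.archi_bound `|M|).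
  exact: le_lt_trans (ler_norm M) (Num.Theory.archi_boundP (normr_ge0 M)).
exists [seq (Posz i - Posz K) | i <- iota 0 (K + K)].
  by rewrite map_inj_uniq ?iota_uniq// => i j /addIr [].
move=> y yM.
have : y < K%:R by rewrite (le_lt_trans (ler_norm y))// (le_lt_trans yM).
have : - K%:R <= y by rewrite lerNl (le_trans _ (ltW MK))// (le_trans _ yM)// -normrN ler_norm.
rewrite -[K%:R]/((Posz K)%:~R) -rmorphN/= -Num.Theory.floor_ge_int -Num.Theory.floor_lt_int.
move: (Num.floor y) => z zK Kz; apply/mapP; exists (absz (z + Posz K)); last by lia.
by rewrite mem_iota; lia.
Qed.

Lemma measurable_fun_simple_approx (f : R -> R[i]) M :
  measurable_fun setT (fun t => complex.Re (f t)) ->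
  measurable_fun setT (fun t => complex.Im (f t)) ->
  (forall t, rnorm (f t) <= M) ->
  exists s : nat -> R -> R[i],
    (forall n, simple_function (s n)) /\
    (forall n t, rnorm (s n t - f t) <= 2 / n.+1%:R).
Proof.
move=> mre mim fM.
(* Real and imaginary parts are rounded down to multiples of [1 / n.+1]; each rounding costs at most
   [1 / n.+1], and boundedness of [f] leaves finitely many values. *)
pose q n t := (Num.floor (n.+1%:R * complex.Re (f t)), Num.floor (n.+1%:R * complex.Im (f t))).
pose k n (p : int * int) : R[i] := (p.1%:~R / n.+1%:R) +i* (p.2%:~R / n.+1%:R).
exists (fun n => k n \o q n); split => [n|n t].
  have mq p : measurable (q n @^-1` [set p]).
    rewrite (_ : _ @^-1` _ =
      (fun t => Num.floor (n.+1%:R * complex.Re (f t))) @^-1` [set p.1] `&`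
      (fun t => Num.floor (n.+1%:R * complex.Im (f t))) @^-1` [set p.2]).
      by apply: measurableI; apply: measurable_floor_fib; exact: measurable_funM.
    by apply/seteqP; split => t /=; [move=> <-|case: p => a b /= [<- <-]].
  have [r ur rP] := floor_range (n.+1%:R * M).
  apply: (@simple_function_comp _ _ _ mq [seq (a, b) | a <- r, b <- r]) => t.
  have h1 := ler_Re_rnorm (f t); have h2 := ler_Im_rnorm (f t).
  by apply: allpairs_f; apply: rP; rewrite normrM ger0_norm// ler_pM2l// (le_trans _ (fM t)).
have floorE (y : R) : `|(Num.floor (n.+1%:R * y))%:~R / n.+1%:R - y| <= 1 / n.+1%:R.
  have n0 : 0 < n.+1%:R :> R by rewrite ltr0n.
  have := Num.Theory.floor_itv (n.+1%:R * y).
  rewrite intrD /=; set a := (Num.floor _)%:~R => /andP[h1 h2].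
  have nn0 : n.+1%:R != 0 :> R by rewrite gt_eqF.
  rewrite (_ : a / _ - y = (a - n.+1%:R * y) / n.+1%:R); last first.
    by rewrite mulrBl mulrAC divff// mul1r.
  rewrite normrM [`|_^-1|]gtr0_norm ?invr_gt0// ler_pM2r ?invr_gt0//.
  by rewrite ler_norml; lra.
apply: le_trans (ler_rnorm_ReIm _) _.
rewrite (_ : 2 / _ = 1 / n.+1%:R + 1 / n.+1%:R); last by rewrite -mulrDl.
by rewrite !raddfB /k /=; exact: lerD.
Qed.

Lemma spectral_integral_exists (f : R -> R[i]) M x :
  measurable_fun setT (fun t => complex.Re (f t)) ->
  measurable_fun setT (fun t => complex.Im (f t)) ->
  (forall t, rnorm (f t) <= M) ->
  exists y, is_spectral_integral E f x y.
Proof.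
move=> mre mim fM.
have [s [ss sf]] := measurable_fun_simple_approx mre mim fM.
have small (e : R) : 0 < e -> exists N : nat, forall n, (N <= n)%N -> 2 / n.+1%:R < e.
  move=> e0; exists (Num.truncn (2 / e)) => n Nn.
  rewrite ltr_pdivrMr ?ltr0n// mulrC -ltr_pdivrMr//.
  have te : 0 <= 2 / e by rewrite divr_ge0// ltW.
  have /andP[_ /lt_le_trans] := Num.Theory.truncn_itv te.
  by apply; rewrite ler_nat.
have cs : cvg ((fun n => simple_integral E (s n) x) @ \oo).
  apply: rcauchy_cvg => e e0.
  have x0 : 0 < rnorm x + 1 by rewrite ltr_wpDl ?rnorm_ge0.
  have [N NP] : exists N : nat, forall n, (N <= n)%N -> 2 / n.+1%:R < e / (rnorm x + 1) / 2.
    by apply: small; rewrite !divr_gt0.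
  exists N => m n Nm Nn.
  have := simple_integral_dist (E := E) Hdot HE (s := s m) (s' := s n)
    (e := 2 / m.+1%:R + 2 / n.+1%:R) x (ss m) (ss n).
  have mn0 : 0 <= 2 / m.+1%:R + 2 / n.+1%:R :> R by rewrite addr_ge0 ?divr_ge0.
  move=> /(_ mn0) H1.
  apply: (@le_lt_trans _ _ ((2 / m.+1%:R + 2 / n.+1%:R) * rnorm x)).
    apply: H1 => t; rewrite -[s m t](subrK (f t)) -addrA.
    by rewrite (le_trans (ler_rnormD _ _))// lerD// rnorm_distC.
  apply: (@le_lt_trans _ _ ((2 / m.+1%:R + 2 / n.+1%:R) * (rnorm x + 1))).
    by rewrite ler_wpM2l// lerDl.
  by rewrite -ltr_pdivlMr// [ltRHS]splitr ltrD ?NP.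
exists (lim ((fun n => simple_integral E (s n) x) @ \oo)), s; split => // e e0.
by have [N NP] := small e e0; exists N => // n /= /NP h t; exact: le_lt_trans h.
Qed.

Lemma spectral_integralP (D : set R) (f : R -> R[i]) M x : measurable D ->
  measurable_fun setT (fun t => complex.Re (f t)) ->
  measurable_fun setT (fun t => complex.Im (f t)) ->
  (forall t, rnorm (f t) <= M) ->
  is_spectral_integral E (fun t => f t * (\1_D t)%:C) x (spectral_integral E D f x).
Proof.
move=> mD mre mim fM.
have m1 : measurable_fun setT (\1_D : R -> R) by exact: measurable_indic.
have M0 : 0 <= M := le_trans (rnorm_ge0 _) (fM 0).
apply: xgetPex; apply: (@spectral_integral_exists _ M).
- rewrite (_ : (fun t => _) = fun t => complex.Re (f t) * \1_D t); first exact: measurable_funM.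
  by apply/funext => t; case: (f t) => a b /=; rewrite mulr0 subr0.
- rewrite (_ : (fun t => _) = fun t => complex.Im (f t) * \1_D t); first exact: measurable_funM.
  by apply/funext => t; case: (f t) => a b /=; rewrite mulr0 add0r.
- move=> t; rewrite indicE; case: (_ \in _) => /=; first by rewrite mulr1.
  by rewrite mulr0 rnorm0.
Qed.

(** The indicator is itself simple, so a constant sequence computes its integral. Hence [W E sigma]
    is the range of the projection for [|t| < sigma]. *)
Lemma spectral_integral_indic (D : set R) x : measurable D ->
  spectral_integral E D (fun=> 1) x = E D x.
Proof.
move=> mD; have r1 : rnorm (1 : R[i]) = 1 by rewrite /rnorm normr1.
have h : is_spectral_integral E (fun t => (1 : R[i]) * (\1_D t)%:C) x
    (spectral_integral E D (fun=> 1) x).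
  by apply: (@spectral_integralP _ _ 1) => //= ?; rewrite r1.
apply: (spectral_integral_unique Hdot HE h).
pose q t := t \in D; pose k (b : bool) : R[i] := (b%:R)%:C.
have mq b : measurable (q @^-1` [set b]).
  case: b; rewrite /q.
    by rewrite (_ : _ @^-1` _ = D)//; apply/seteqP; split => t; [exact: set_mem|exact: mem_set].
  rewrite (_ : _ @^-1` _ = ~` D); first exact: measurableC.
  apply/seteqP; split => t /=; first by move=> /negP + Dt; apply; rewrite inE.
  by move=> nD; apply/negbTE/negP; rewrite inE.
have qr t : q t \in [:: true; false] by case: (q t).
have qE t : (1 : R[i]) * (\1_D t)%:C = k (q t) by rewrite mul1r indicE.
exists (fun=> k \o q); split.
- by move=> n; exact: (simple_function_comp mq qr).
- by move=> e e0; apply: nearW => n t; rewrite qE subrr rnorm0.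
- rewrite (simple_integral_comp HE mq (isT : uniq [:: true; false]) qr) !big_cons big_nil.
  rewrite /k/= scale1r scale0r !addr0.
  rewrite (_ : q @^-1` [set true] = D); first exact: cvg_cst.
  by apply/seteqP; split => t; [exact: set_mem|exact: mem_set].
Qed.

(** The projection of [x] on the frequencies below [sigma] is an admissible competitor, and its
    error is the projection on the complement. *)
Lemma best_approx_le sigma x :
  best_approx E sigma x <= rnorm (E [set t | sigma <= `|t|] x).
Proof.
have mD : measurable [set t : R | `|t| < sigma].
  rewrite (_ : mkset _ = (fun t : R => `|t|) @^-1` `]-oo, sigma[); last first.
    by apply/seteqP; split => t; rewrite /= in_itv.
  by rewrite -[_ @^-1` _]setTI; apply: normr_measurable => //; exact: measurable_itv.
have DC : [set t : R | sigma <= `|t|] = ~` [set t : R | `|t| < sigma].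
  by apply/seteqP; split => t /=; rewrite leNgt => /negP.
apply: ge_inf; first by exists 0 => _ [h _ <-]; exact: rnorm_ge0.
exists (E [set t | `|t| < sigma] x).
  by exists x => //; exact: spectral_integral_indic.
congr rnorm; rewrite DC; apply/eqP; rewrite subr_eq; apply/eqP.
rewrite -[LHS](roi_setT HE) -(setvU [set t : R | `|t| < sigma]).
by apply: (roi_setU HE) => //; [exact: measurableC|rewrite setICl].
Qed.

End Existence.

(** * The generalized modulus of continuity *)

Section Continuity.
Context {R : realType}.

Lemma continuous_expi : continuous (@expi R : R -> R[i]^o).
Proof.
move=> t; apply/cvgrPdist_lt => e /gt0_complexE[-> e0].
have e2 : 0 < complex.Re e / 2 by rewrite divr_gt0.
have /cvgrPdist_lt/(_ _ e2) hc := @continuous_cos R t.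
have /cvgrPdist_lt/(_ _ e2) hs := @continuous_sin R t.
near=> s; rewrite normC_rnorm ltcR (le_lt_trans (ler_rnorm_ReIm _))//.
rewrite !raddfB /= [ltRHS]splitr ltrD//; near: s; [exact: hc|exact: hs].
Unshelve. all: by end_near. Qed.

Lemma continuous_ler_rnorm (g : R[i] -> R) :
  (forall z w, `|g z - g w| <= rnorm (z - w)) -> continuous (g : R[i]^o -> R).
Proof.
move=> gL z; apply/(cvgrPdist_lt (FF := nbhs_filter (z : R[i]^o))) => e e0.
have eC : 0 < e%:C :> R[i] by rewrite ltcR.
apply/(@nbhs_ballP _ R[i]^o); exists e%:C => //= w.
by rewrite -ball_normE/= normC_rnorm ltcR; exact: le_lt_trans.
Qed.

Lemma continuous_Re : continuous (@complex.Re R : R[i]^o -> R).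
Proof.
by apply: continuous_ler_rnorm => z w; rewrite -raddfB; exact: ler_Re_rnorm.
Qed.

Lemma continuous_Im : continuous (@complex.Im R : R[i]^o -> R).
Proof.
by apply: continuous_ler_rnorm => z w; rewrite -raddfB; exact: ler_Im_rnorm.
Qed.

Lemma continuous_phi_expi (phi : R[i] -> R[i]) (g : R[i] -> R) (t : R) :
  continuous (phi : R[i]^o -> R[i]^o) -> continuous (g : R[i]^o -> R) ->
  continuous (fun s : R => g (phi (expi (t * s)))).
Proof.
move=> cphi cg s.
apply: (@continuous_comp _ R[i]^o _ (fun s : R => phi (expi (t * s))) g); last exact: cg.
apply: (@continuous_comp _ R[i]^o R[i]^o (fun s : R => expi (t * s)) phi); last exact: cphi.
apply: (@continuous_comp _ _ R[i]^o (fun s : R => t * s) (@expi R)); last exact: continuous_expi.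
by apply: cvgM; [exact: cvg_cst|exact: cvg_id].
Qed.

Lemma periodic_even_bounded (psi : R -> R) : continuous psi ->
  (forall t, psi (- t) = psi t) -> (forall t, psi (t + 2 * pi) = psi t) ->
  exists M, forall t, psi t <= M.
Proof.
move=> cpsi ev per; have pi0 := pi_gt0 R; have T0 : 0 < 2 * pi :> R by lra.
have [c _ cP] := EVT_max (ltW T0) (continuous_subspaceT cpsi).
exists (psi c) => t.
(* Evenness moves the point to the right half-line, since [natmul_periodic] handles only natural
   multiples of the period. *)
have -> : psi t = psi `|t| by case: (ler0P t) => // _; rewrite ev.
have /andP[t1 t2] := truncn_mulrn T0 (normr_ge0 t).
set n := Num.truncn _ in t1 t2.
have := @natmul_periodic _ psi (2 * pi) 0 n (`|t| - 2 * pi *+ n).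
rewrite subrK mul0rn addr0 => -> ; last by move=> s; rewrite addr0.
by apply: cP; rewrite in_itv/= subr_ge0 t1/= lerBlDr -mulrS ltW.
Qed.

End Continuity.

(** * Lower bound for the weighted square mean of [Delta E phi t x] *)

Section WeightedModulus.
Context {R : realType} {H : completeNormedModType R[i]}.
Variables (dot : {dot H for @Num.conj R[i]}) (E : set R -> H -> H).
Hypotheses (Hdot : norm_from_dot dot) (HE : resolution_of_identity dot E).
Variables (phi : R[i] -> R[i]) (psi : R -> R).
Hypotheses (Cphi : continuous (phi : R[i]^o -> R[i]^o))
  (psiE : forall t, psi t = rnorm (phi (expi t)) ^+ 2) (Hpsi : Psi psi).
Variable x : H.

Let psi_ge0 t : 0 <= psi t. Proof. by rewrite psiE sqr_ge0. Qed.

Let psi_continuous : continuous psi. Proof. by case: Hpsi => -[]. Qed.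

Let psi_even t : psi (- t) = psi t.
Proof. by case: Hpsi => _ /(_ t)[]. Qed.

Let psi_periodic t : psi (t + 2 * pi) = psi t.
Proof. by case: Hpsi => -[_ _]. Qed.

Let psi_abs t s : psi (t * s) = psi (`|s| * t).
Proof. by case: (ler0P s) => _; rewrite ?mulNr ?psi_even mulrC. Qed.

Let psi_scale_continuous t : continuous (fun s : R => psi (t * s)).
Proof.
move=> s; apply: (@continuous_comp _ _ _ (fun s : R => t * s) psi); last exact: psi_continuous.
by apply: cvgM; [exact: cvg_cst|exact: cvg_id].
Qed.

Lemma rnorm_phi_bounded : exists M, forall t, rnorm (phi (expi t)) <= M.
Proof.
have [M MP] := periodic_even_bounded psi_continuous psi_even psi_periodic.
exists (M + 1) => t; have := MP t; rewrite psiE; have := rnorm_ge0 (phi (expi t)).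
by nra.
Qed.

Section Mu.
Variable mu : {finite_measure set R -> \bar R}.
Hypothesis muE : forall B, mu B = (rnorm (E B x) ^+ 2)%:E.

Lemma sqr_rnorm_Delta t :
  (rnorm (Delta E phi t x) ^+ 2)%:E = (\int[mu]_s (psi (t * s))%:E)%E.
Proof.
have [M MP] := rnorm_phi_bounded.
have cP g : continuous (g : R[i]^o -> R) ->
    measurable_fun setT (fun s : R => g (phi (expi (t * s)))).
  by move=> cg; apply: continuous_measurable_fun; exact: (@continuous_phi_expi _ phi g t Cphi cg).
have := spectral_integralP Hdot HE x measurableT (cP _ continuous_Re)
  (cP _ continuous_Im) (fun s => MP (t * s)).
move=> h; rewrite (spectral_integral_isometry Hdot HE muE h (M := M)); last first.
  by move=> s; rewrite indicT mulr1.
by apply: eq_integral => s _; rewrite indicT mulr1 psiE.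
Qed.

Lemma measurable_psiM : measurable_fun setT (fun p : R * R => psi (p.1 * p.2)).
Proof.
apply: (measurableT_comp (f := psi)); first exact: (continuous_measurable_fun psi_continuous).
by apply: measurable_funM; [exact: measurable_fst|exact: measurable_snd].
Qed.

(** Measurability in [t] comes from Tonelli applied to the formula for the squared norm, with no
    continuity of [Delta E phi t x] in [t] to be established. *)
Lemma measurable_sqr_rnorm_Delta :
  measurable_fun setT (fun t => rnorm (Delta E phi t x) ^+ 2).
Proof.
apply/measurable_EFinP.
rewrite (_ : EFin \o _ = fubini_F mu (fun p : R * R => (psi (p.1 * p.2))%:E)).
  apply: measurable_fun_fubini_tonelli_F => [|p]; last by rewrite lee_fin.
  by apply/measurable_EFinP; exact: measurable_psiM.
by apply/funext => t; rewrite /= sqr_rnorm_Delta.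
Qed.

Lemma rnorm_Delta_bounded : exists M, forall t, 0 <= rnorm (Delta E phi t x) <= M.
Proof.
have [M MP] := periodic_even_bounded psi_continuous psi_even psi_periodic.
exists (M * rnorm x ^+ 2 + 1) => t; rewrite rnorm_ge0/=.
suff : rnorm (Delta E phi t x) ^+ 2 <= M * rnorm x ^+ 2.
  by have := rnorm_ge0 (Delta E phi t x); nra.
rewrite -lee_fin sqr_rnorm_Delta EFinM -(spectral_mu_setT HE muE).
have M0 : 0 <= M := le_trans (psi_ge0 0) (MP 0).
rewrite -(integral_cst mu measurableT M%:E).
apply: ge0_le_integral => //.
- by move=> s _; rewrite lee_fin.
- apply/measurable_EFinP. apply: continuous_measurable_fun; exact: psi_scale_continuous.
- by move=> s _; rewrite lee_fin.
Qed.

Lemma weighted_modulus_ge (sigma d : R) : 0 < sigma -> 0 < d ->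
  7 * pi / 5 <= sigma * d ->
  mean psi * rnorm (E [set t | sigma <= `|t|] x) ^+ 2 * d <=
  \int[lebesgue_measure]_(t in `[0, d])
    (rnorm (Delta E phi t x) ^+ 2 * Vstar (t / d)).
Proof.
move=> sigma0 d0 sd; set A := [set t | _].
have mA : measurable A.
  rewrite (_ : A = (fun t : R => `|t|) @^-1` `[sigma, +oo[); last first.
    by apply/seteqP; split => t; rewrite /A/= in_itv/= andbT.
  by rewrite -[_ @^-1` _]setTI; apply: normr_measurable => //; exact: measurable_itv.
(* The cut-off turns both integrals into integrals over the whole line; it also gives a weight that
   is nonnegative everywhere, whereas [Vstar] is negative to the left of 0. *)
pose V1 (t : R) : R := Vstar (t / d) * \1_(`[0, d]%classic) t.
have V1ge0 t : 0 <= V1 t.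
  rewrite /V1 indicE; case: (boolP (t \in _)); last by rewrite mulr0.
  by rewrite inE/= in_itv/= mulr1; exact: Vstar_ge0.
have mV1 : measurable_fun setT V1.
  apply: measurable_funM; last exact: measurable_indic.
  by apply: continuous_measurable_fun; exact: Vstar_continuous.
have toV1 (g : R -> R) : (\int[@lebesgue_measure R]_(t in `[0%R, d]) (g t * Vstar (t / d))%:E =
    \int[@lebesgue_measure R]_t (g t * V1 t)%:E)%E.
  rewrite integral_mkcond; apply: eq_integral => t _; rewrite patchE /V1 indicE.
  by case: ifP => _; rewrite ?mulr1// !mulr0.
have [M MP] := rnorm_Delta_bounded.
have if2 : (@lebesgue_measure R).-integrable `[0, d]
    (EFin \o (fun t => rnorm (Delta E phi t x) ^+ 2 * Vstar (t / d))).
  apply: (@itv_weighted_integrable _ (fun t => rnorm (Delta E phi t x) ^+ 2) d (M ^+ 2)) => //.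
    exact: measurable_sqr_rnorm_Delta.
  move=> t; rewrite sqr_ge0/=; have /andP[h1 h2] := MP t.
  by rewrite lerXn2r ?nnegrE// (le_trans h1).
(* The real integral is the [fine] part of an extended one, which would be 0 at infinity; finiteness
   is needed before comparing extended integrals. *)
rewrite -lee_fin /Rintegral fineK; last first.
  by apply: integrable_fin_num if2.
rewrite (toV1 (fun t => rnorm (Delta E phi t x) ^+ 2)).
have -> : (\int[@lebesgue_measure R]_t (rnorm (Delta E phi t x) ^+ 2 * V1 t)%:E =
    \int[@lebesgue_measure R]_t \int[mu]_s (psi (t * s) * V1 t)%:E)%E.
  apply: eq_integral => t _.
  under [RHS]eq_integral do rewrite mulrC EFinM.
  rewrite ge0_integralZl_EFin//.
  - by rewrite -sqr_rnorm_Delta -EFinM mulrC.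
  - by move=> s _; rewrite lee_fin.
  - by apply/measurable_EFinP; apply: continuous_measurable_fun; exact: psi_scale_continuous.
have mg : measurable_fun setT (fun p : R * R => (psi (p.1 * p.2) * V1 p.1)%:E).
  apply/measurable_EFinP/measurable_funM; first exact: measurable_psiM.
  by apply: measurableT_comp => //; exact: measurable_fst.
have g0 (p : R * R) : (0 <= (psi (p.1 * p.2) * V1 p.1)%:E)%E.
  by rewrite lee_fin mulr_ge0.
rewrite (fubini_tonelli (m1 := @lebesgue_measure R) (m2 := mu) _ mg g0)/=.
have mG := measurable_fun_fubini_tonelli_G (m1 := @lebesgue_measure R) _ mg g0.
rewrite mulrAC EFinM -muE -(integral_cst mu mA (mean psi * d)%:E).
(* The frequencies below [sigma] are discarded, the integrand being nonnegative; for each remaining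
   [s] the scalar inequality applies with [c] equal to the modulus of [s]. *)
apply: (@le_trans _ _
    (\int[mu]_(s in A) \int[@lebesgue_measure R]_t (psi (t * s) * V1 t)%:E)%E); last first.
  apply: ge0_subset_integral => // s _.
  by apply: integral_ge0 => t _; exact: (g0 (t, s)).
have m0 : 0 < mean psi by apply: mean_gt0; case: Hpsi.
apply: ge0_le_integral => //.
- by move=> s _; rewrite lee_fin mulr_ge0// ltW.
- exact: measurable_funTS.
move=> s As; rewrite -(toV1 (fun t => psi (t * s))).
have s0 : 0 < `|s| := lt_le_trans sigma0 As.
have sd' : 7 * pi / 5 <= `|s| * d by rewrite (le_trans sd)// ler_wpM2r// ltW.
have := Psi_weighted_mean Hpsi s0 d0 sd'; rewrite -lee_fin => /le_trans; apply.
rewrite /Rintegral fineK.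
  by under eq_integral do rewrite -psi_abs.
apply: integrable_fin_num => //.
apply: (@continuous_integrable _ (fun t => psi (`|s| * t) * Vstar (t / d))) => t.
by apply: cvgM; [exact: psi_scale_continuous|exact: Vstar_continuous].
Qed.

End Mu.

End WeightedModulus.

Theorem mainTheorem7 (R : realType) (H : completeNormedModType R[i])
    (dot : {dot H for @Num.conj R[i]}) (E : set R -> H -> H)
    (Hdot : norm_from_dot dot) (HE : resolution_of_identity dot E)
    (phi : R[i] -> R[i]) (Cphi : continuous (phi : R[i]^o -> R[i]^o))
    (psi : R -> R) (psiE : forall t, psi t = rnorm (phi (expi t)) ^+ 2)
    (Hpsi : Psi psi)
    (gamma : R) (Hgamma : 7 * pi / 5 <= gamma)
    (x : H) (sigma : R) (Hsigma : 0 < sigma) :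
  (forall p : \bar R, (2%:E <= p)%E ->
     best_approx E sigma x <=
       (Num.sqrt (mean psi))^-1 * omega E phi x p Vstar (gamma / sigma)) /\
  best_approx E sigma x <=
    (Num.sqrt (mean psi))^-1 * omega_C E phi x (gamma / sigma).
Proof.
have m0 : 0 < mean psi by apply: mean_gt0; case: Hpsi.
have pi0 := pi_gt0 R.
set d := gamma / sigma.
have d0 : 0 < d by rewrite divr_gt0//; lra.
have sd : 7 * pi / 5 <= sigma * d by rewrite /d [sigma * _]mulrC divfK ?gt_eqF.
have [mu muE] := exists_spectral_measure Hdot HE x.
have key := weighted_modulus_ge Hdot HE Cphi psiE Hpsi muE Hsigma d0 sd.
have mf2 := measurable_sqr_rnorm_Delta Hdot HE Cphi psiE Hpsi muE.
have [M fM] := rnorm_Delta_bounded Hdot HE Cphi psiE Hpsi muE.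
set a := rnorm (E _ x) in key.
have ba : best_approx E sigma x <= a := best_approx_le Hdot HE sigma x.
(* The mean inequalities require [A = mean psi * a ^+ 2] to be positive; when [a = 0] the claim is
   just that the modulus [w] is nonnegative. *)
have reduce w : 0 <= w -> (0 < a -> Num.sqrt (mean psi * a ^+ 2) <= w) ->
    best_approx E sigma x <= (Num.sqrt (mean psi))^-1 * w.
  move=> w0 aw; apply: (le_trans ba); rewrite mulrC ler_pdivlMr ?sqrtr_gt0//.
  have := rnorm_ge0 (E [set t | sigma <= `|t|] x).
  rewrite -/a le_eqVlt => /predU1P[<-|a0]; first by rewrite mul0r.
  apply: le_trans (aw a0).
  by rewrite (sqrtrM (a ^+ 2) (ltW m0)) sqrtr_sqr gtr0_norm// [a * _]mulrC.
have A0 : 0 < a -> 0 < mean psi * a ^+ 2 by move=> a0; rewrite mulr_gt0 ?exprn_gt0.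
have supW : best_approx E sigma x <=
    (Num.sqrt (mean psi))^-1 * omega_C E phi x d.
  apply: reduce => [|a0]; last exact: (weighted_sup_mean d0 (A0 a0) fM mf2 key).
  (* The supremum is nonnegative because it dominates the value at [t = 0]; the bound [M] makes it a
     genuine supremum. *)
  apply: (@le_trans _ _ (rnorm (Delta E phi 0 x))); first exact: rnorm_ge0.
  apply: ub_le_sup; first by exists M => _ [t _ <-]; case/andP: (fM t).
  by exists 0 => //=; rewrite in_itv/= lexx ltW.
(* The case [+oo] is [supW], and [-oo] contradicts [2 <= p]; only finite exponents remain. *)
split=> // -[q||] //=; rewrite lee_fin => q2.
apply: reduce => [|a0]; first exact: powR_ge0.
exact: (weighted_power_mean d0 (A0 a0) q2 fM mf2 key).
Qed.
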